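(* Let $(A,\Delta)$ be an algebraic quantum group and let $h$ be a group-like projection in $A$. Put $A_0=hAh$ and define $\Delta_0(a)=(h\otimes h)\Delta(a)(h\otimes h)$ for $a\in A_0$. Then the pair $(A_0,\Delta_0)$ is an algebraic quantum hypergroup of compact type.
   Context: Algebras are over $\mathbb C$, possibly without identity, with non-degenerate product; $\otimes$ is the algebraic tensor product, $M(A)$ is the multiplier algebra of $A$, $\iota$ is the identity map. A multiplier Hopf $^*$-algebra is a $^*$-algebra $A$ with a non-degenerate coassociative $^*$-homomorphism $\Delta:A\to M(A\otimes A)$ such that $a\otimes b\mapsto\Delta(a)(1\otimes b)$ and $a\otimes b\mapsto(a\otimes1)\Delta(b)$ are bijections from $A\otimes A$ onto $A\otimes A$. It has a unique counit $\varepsilon$ and a unique antipode $S$. An algebraic quantum group is a multiplier Hopf $^*$-algebra with a positive left integral $\varphi$: a non-zero linear functional with $\varphi(a^*a)\ge0$ and $(\iota\otimes\varphi)\Delta(a)=\varphi(a)1$ for all $a\in A$. A group-like projection is a non-zero $h\in A$ with $h^2=h=h^*$ and $\Delta(h)(1\otimes h)=h\otimes h$. An algebraic quantum hypergroup is a pair $(D,\Delta)$ of an algebra $D$ with non-degenerate product and a linear map $\Delta:D\to M(D\otimes D)$ (not necessarily a homomorphism) such that: (1) the elements $\Delta(a)(1\otimes b)$, $(a\otimes1)\Delta(b)$, $\Delta(a)(b\otimes1)$, $(1\otimes a)\Delta(b)$ all lie in $D\otimes D$; (2) $\Delta$ is coassociative: $(c\otimes1\otimes1)(\Delta\otimes\iota)(\Delta(a)(1\otimes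 b))=(\iota\otimes\Delta)((c\otimes1)\Delta(a))(1\otimes1\otimes b)$ for all $a,b,c\in D$; (3) there is a counit, i.e. a homomorphism $\varepsilon:D\to\mathbb C$ with $(\varepsilon\otimes\iota)\Delta(a)=a=(\iota\otimes\varepsilon)\Delta(a)$ for all $a$; (4) there is a faithful left invariant functional $\varphi$ on $D$: $(\iota\otimes\varphi)\Delta(a)=\varphi(a)1$ for all $a$, and $b=0$ whenever $\varphi(ab)=0$ for all $a$ or $\varphi(ba)=0$ for all $a$; (5) there is an antipode relative to $\varphi$, i.e. a bijective anti-homomorphism $S:D\to D$ with $S\big((\iota\otimes\varphi)(\Delta(a)(1\otimes b))\big)=(\iota\otimes\varphi)((1\otimes a)\Delta(b))$ for all $a,b\in D$. It is of compact type if $D$ has an identity (here the identity of $A_0$ is $h$). *)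

(* Defs.v *)
From HB Require Import structures.
From mathcomp Require Import all_boot all_order all_algebra.
From mathcomp Require Import boolp classical_sets reals.
From mathcomp Require Import complex.

Set Implicit Arguments.
Unset Strict Implicit.
Unset Printing Implicit Defensive.

Import Order.TTheory GRing.Theory Num.Theory.
Local Open Scope classical_set_scope.
Local Open Scope ring_scope.
Local Open Scope quotient_scope.

Declare Scope nualg_scope.
Delimit Scope nualg_scope with nualg.

Lemma linearPD (K : pzRingType) (U V : lmodType K) (f : U -> V) :
  linear f -> {morph f : x y / x + y}.
Proof. by move=> fl x y; have := fl 1 x y; rewrite !scale1r. Qed.
Lemma linearP0 (K : pzRingType) (U V : lmodType K) (f : U -> V) :
  linear f -> f 0 = 0.
Proof. by move=> /linearPD fD; apply: (addrI (f 0)); rewrite -fD !addr0. Qed.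
Lemma linearPZ (K : pzRingType) (U V : lmodType K) (f : U -> V) :
  linear f -> forall c x, f (c *: x) = c *: f x.
Proof. by move=> fl c x; have := fl c x 0; rewrite (linearP0 fl) !addr0. Qed.

(******************************************************************************)
(*            Associative algebras, possibly without identity                 *)
(******************************************************************************)

HB.mixin Record Lmodule_isNUAlgebra (K : fieldType) V of GRing.Lmodule K V := {
  numul : V -> V -> V;
  numulA : associative numul;
  numul_linearl : forall b, linear (numul^~ b);
  numul_linearr : forall a, linear (numul a)
}.

#[short(type="nualgType")]
HB.structure Definition NUAlgebra (K : fieldType) :=
  {V of Lmodule_isNUAlgebra K V & GRing.Lmodule K V}.

Notation "x ** y" := (numul x y) (at level 40, left associativity) : nualg_scope.
Local Open Scope nualg_scope.

HB.mixin Record NUAlgebra_isStar (K : numClosedFieldType) V of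
    NUAlgebra K V := {
  star : V -> V;
  starK : involutive star;
  starM : forall x y : V, star (x ** y) = star y ** star x;
  starZD : forall (c : K) (x y : V), star (c *: x + y) = c^* *: star x + star y
}.

#[short(type="starAlgType")]
HB.structure Definition StarAlgebra (K : numClosedFieldType) :=
  {V of NUAlgebra_isStar K V & NUAlgebra K V}.

HB.instance Definition _ (K : fieldType) (A : nualgType K) (a : A) :=
  GRing.isLinear.Build K A A *:%R (numul a) (numul_linearr a).

Section NUAlgebraTheory.
Variables (K : fieldType) (A : nualgType K).
Implicit Types a b x y : A.

Lemma numulDl x y b : (x + y) ** b = x ** b + y ** b.
Proof. by have := numul_linearl b 1 x y; rewrite !scale1r. Qed.
Lemma numulDr a x y : a ** (x + y) = a ** x + a ** y.
Proof. exact: linearD. Qed.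
Lemma numul0l b : 0 ** b = 0.
Proof. by apply: (addrI (0 ** b)); rewrite -numulDl !addr0. Qed.
Lemma numul0r a : a ** 0 = 0.
Proof. exact: linear0. Qed.
Lemma numulZl c x b : (c *: x) ** b = c *: (x ** b).
Proof. by have := numul_linearl b c x 0; rewrite numul0l !addr0. Qed.
Lemma numulZr c a x : a ** (c *: x) = c *: (a ** x).
Proof. exact: linearZ. Qed.

Definition nondegenerate :=
  (forall a, (forall b, a ** b = 0) -> a = 0) /\
  (forall a, (forall b, b ** a = 0) -> a = 0).

Definition is_identity (e : A) := forall x, e ** x = x /\ x ** e = x.

End NUAlgebraTheory.

Arguments nondegenerate {K} A.

Section StarTheory.
Variables (K : numClosedFieldType) (A : starAlgType K).
Lemma starD (x y : A) : star (x + y) = star x + star y.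
Proof. by have := starZD 1 x y; rewrite !scale1r rmorph1 scale1r. Qed.
Lemma star0 : star (0 : A) = 0.
Proof. by apply: (addrI (star 0)); rewrite -starD !addr0. Qed.
Lemma starZ (c : K) (x : A) : star (c *: x) = c^* *: star x.
Proof. by have := starZD c x 0; rewrite star0 !addr0. Qed.
End StarTheory.

(******************************************************************************)
(*                     The algebraic tensor product                           *)
(******************************************************************************)

(* A finite formal sum of symbols a \ox b is a list of pairs; tens_eq is the  *)
(* congruence generated by the bilinearity relations.                         *)
Section TensorRel.
Variables (K : fieldType) (A B : lmodType K).

Inductive tens_eq : seq (A * B) -> seq (A * B) -> Prop :=
| tens_eq_refl s : tens_eq s s
| tens_eq_sym s t : tens_eq s t -> tens_eq t s
| tens_eq_trans s t u : tens_eq s t -> tens_eq t u -> tens_eq s u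
| tens_eq_cat s s' t t' :
    tens_eq s s' -> tens_eq t t' -> tens_eq (s ++ t) (s' ++ t')
| tens_eq_catC s t : tens_eq (s ++ t) (t ++ s)
| tens_eq_addl a a' b : tens_eq [:: (a + a', b)] [:: (a, b); (a', b)]
| tens_eq_addr a b b' : tens_eq [:: (a, b + b')] [:: (a, b); (a, b')]
| tens_eq_scale c a b : tens_eq [:: (c *: a, b)] [:: (a, c *: b)]
| tens_eq_0 b : tens_eq [:: (0, b)] [::].

Definition tens_eqb s t := `[< tens_eq s t >].
Lemma tens_eqb_refl : reflexive tens_eqb.
Proof. by move=> s; apply/asboolP; apply: tens_eq_refl. Qed.
Lemma tens_eqb_sym : symmetric tens_eqb.
Proof. by move=> s t; apply/asboolP/asboolP; apply: tens_eq_sym. Qed.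
Lemma tens_eqb_trans : transitive tens_eqb.
Proof.
by move=> t s u /asboolP st /asboolP tu; apply/asboolP; apply: tens_eq_trans tu.
Qed.
Canonical tens_equiv := EquivRel tens_eqb tens_eqb_refl tens_eqb_sym tens_eqb_trans.

Definition tens := {eq_quot tens_equiv}.
HB.instance Definition _ := Choice.on tens.
HB.instance Definition _ := EqQuotient.on tens.

Definition tens_of (s : seq (A * B)) : tens := \pi_tens s.

Lemma tens_ofP s t : tens_of s = tens_of t <-> tens_eq s t.
Proof.
by split=> [/eqquotP /asboolP //|st]; apply/eqquotP; apply/asboolP.
Qed.

Lemma tens_ofK s : tens_eq (repr (tens_of s)) s.
Proof. by apply/tens_ofP; rewrite /tens_of reprK. Qed.

Lemma tens_reprK (x : tens) : tens_of (repr x) = x.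
Proof. exact: reprK. Qed.

(* the linear extension of a map (a, b) |-> f a b; see tsum_tens *)
Definition tsum (V : zmodType) (f : A -> B -> V) (x : tens) : V :=
  \sum_(p <- repr x) f p.1 p.2.

Definition balanced (V : zmodType) (f : A -> B -> V) :=
  [/\ forall a a' b, f (a + a') b = f a b + f a' b,
      forall a b b', f a (b + b') = f a b + f a b' &
      forall c a b, f (c *: a) b = f a (c *: b)].

Lemma tens_eq_sum (V : zmodType) (f : A -> B -> V) s t :
  balanced f -> tens_eq s t ->
  \sum_(p <- s) f p.1 p.2 = \sum_(p <- t) f p.1 p.2.
Proof.
case=> fDl fDr fZ; elim=> //.
- by move=> {}s {}t u _ -> _ ->.
- by move=> {}s s' {}t t' _ IHs _ IHt; rewrite !big_cat IHs IHt.
- by move=> {}s {}t; rewrite !big_cat /= addrC.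
- by move=> a a' b; rewrite !big_cons !big_nil /= fDl !addr0.
- by move=> a b b'; rewrite !big_cons !big_nil /= fDr !addr0.
- by move=> c a b; rewrite !big_cons !big_nil /= fZ.
- move=> b; rewrite !big_cons !big_nil /= addr0.
  by apply: (addrI (f 0 b)); rewrite -fDl !addr0.
Qed.

Lemma tsum_of (V : zmodType) (f : A -> B -> V) s :
  balanced f -> tsum f (tens_of s) = \sum_(p <- s) f p.1 p.2.
Proof. by move=> bf; apply: tens_eq_sum (tens_ofK s). Qed.

Definition tens_map (f : A -> A) (s : seq (A * B)) := [seq (f p.1, p.2) | p <- s].

Lemma tens_eq_map (f : A -> A) s t : linear f ->
  tens_eq s t -> tens_eq (tens_map f s) (tens_map f t).
Proof.
move=> fl; have [f0 fD fZ] := And3 (linearP0 fl) (linearPD fl) (linearPZ fl).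
elim=> /=.
- by move=> *; apply: tens_eq_refl.
- by move=> *; apply: tens_eq_sym.
- by move=> {}s {}t u _ ? _ ?; apply: (@tens_eq_trans _ (tens_map f t)).
- by move=> *; rewrite /tens_map !map_cat; apply: tens_eq_cat.
- by move=> *; rewrite /tens_map !map_cat; apply: tens_eq_catC.
- by move=> a a' b; rewrite fD; apply: tens_eq_addl.
- by move=> a b b'; apply: tens_eq_addr.
- by move=> c a b; rewrite fZ; apply: tens_eq_scale.
- by move=> b; rewrite f0; apply: tens_eq_0.
Qed.

Definition tens_add (x y : tens) := tens_of (repr x ++ repr y).
Definition tens_scale c (x : tens) := tens_of (tens_map ( *:%R c) (repr x)).
Definition tens_opp (x : tens) := tens_of (tens_map -%R (repr x)).

Lemma tens_of_cat s t : tens_add (tens_of s) (tens_of t) = tens_of (s ++ t).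
Proof. by apply/tens_ofP; apply: tens_eq_cat; apply: tens_ofK. Qed.

Lemma tens_ofZ c s : tens_scale c (tens_of s) = tens_of (tens_map ( *:%R c) s).
Proof.
apply/tens_ofP; apply: tens_eq_map (tens_ofK s).
by move=> d u v; rewrite scalerDr !scalerA mulrC.
Qed.

Lemma tens_ofN s : tens_opp (tens_of s) = tens_of (tens_map -%R s).
Proof.
apply/tens_ofP; apply: tens_eq_map (tens_ofK s).
by move=> d u v; rewrite opprD scalerN.
Qed.

Lemma tens_addA : associative tens_add.
Proof.
move=> x y z; rewrite -(tens_reprK x) -(tens_reprK y) -(tens_reprK z).
by rewrite !tens_of_cat catA.
Qed.

Lemma tens_addC : commutative tens_add.
Proof. by move=> x y; apply/tens_ofP; apply: tens_eq_catC. Qed.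

Lemma tens_add0 : left_id (tens_of [::]) tens_add.
Proof. by move=> x; rewrite -[in LHS](tens_reprK x) tens_of_cat tens_reprK. Qed.

Lemma tens_addN : left_inverse (tens_of [::]) tens_opp tens_add.
Proof.
move=> x; rewrite -(tens_reprK x) tens_ofN tens_of_cat; apply/tens_ofP.
elim: (repr x) => [|[a b] s IH]; first exact: tens_eq_refl.
rewrite /= -cat1s -[(a, b) :: s]cat1s.
apply: (@tens_eq_trans _ (([:: (- a, b)] ++ [:: (a, b)]) ++ (tens_map -%R s ++ s))).
  rewrite -[in X in tens_eq _ X]catA; apply: tens_eq_cat; first exact: tens_eq_refl.
  rewrite !catA; apply: tens_eq_cat; last exact: tens_eq_refl.
  exact: tens_eq_catC.
rewrite -[[::]]/([::] ++ [::]); apply: tens_eq_cat; last exact: IH.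
apply: tens_eq_trans (tens_eq_0 b); apply: tens_eq_sym.
by rewrite -(addNr a); apply: tens_eq_addl.
Qed.

HB.instance Definition _ :=
  GRing.isZmodule.Build tens tens_addA tens_addC tens_add0 tens_addN.

Lemma tens_of0 : tens_of [::] = 0. Proof. by []. Qed.
Lemma tens_ofD s t : tens_of (s ++ t) = tens_of s + tens_of t.
Proof. by rewrite -tens_of_cat. Qed.

Lemma tens_scaleA c d x : tens_scale c (tens_scale d x) = tens_scale (c * d) x.
Proof.
rewrite -(tens_reprK x) !tens_ofZ /tens_map -map_comp; congr tens_of.
by apply: eq_map => p /=; rewrite scalerA.
Qed.

Lemma tens_scale1 : left_id 1 tens_scale.
Proof.
move=> x; rewrite -[in LHS](tens_reprK x) tens_ofZ -[RHS]tens_reprK.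
by congr tens_of; rewrite -[RHS]map_id; apply: eq_map => -[a b]; rewrite /= scale1r.
Qed.

Lemma tens_scaleDr : right_distributive tens_scale +%R.
Proof.
move=> c x y; rewrite -(tens_reprK x) -(tens_reprK y) -tens_ofD !tens_ofZ.
by rewrite /tens_map map_cat tens_ofD.
Qed.

Lemma tens_scaleDl x : {morph tens_scale^~ x : c d / c + d}.
Proof.
move=> c d; rewrite -(tens_reprK x) !tens_ofZ.
elim: (repr x) => [|[a b] s IH]; first by rewrite tens_of0 addr0.
rewrite /= -cat1s -[(c *: a, b) :: _]cat1s -[(d *: a, b) :: _]cat1s !tens_ofD IH.
rewrite [RHS]addrACA; congr (_ + _); rewrite scalerDl -tens_ofD.
by apply/tens_ofP; apply: tens_eq_addl.
Qed.

HB.instance Definition _ := GRing.Zmodule_isLmodule.Build K tens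
  tens_scaleA tens_scale1 tens_scaleDr tens_scaleDl.

Definition tensor (a : A) (b : B) : tens := tens_of [:: (a, b)].

Lemma tensorDl a a' b : tensor (a + a') b = tensor a b + tensor a' b.
Proof. by rewrite -tens_ofD; apply/tens_ofP; apply: tens_eq_addl. Qed.
Lemma tensorDr a b b' : tensor a (b + b') = tensor a b + tensor a b'.
Proof. by rewrite -tens_ofD; apply/tens_ofP; apply: tens_eq_addr. Qed.
Lemma tensorZl c a b : tensor (c *: a) b = c *: tensor a b.
Proof. by apply/esym; apply: tens_ofZ. Qed.
Lemma tensorZr c a b : tensor a (c *: b) = c *: tensor a b.
Proof.
by rewrite -tensorZl; apply/esym; apply/tens_ofP; apply: tens_eq_scale.
Qed.

Lemma tens_ind (P : tens -> Prop) :
  P 0 -> (forall a b x, P x -> P (tensor a b + x)) -> forall x, P x.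
Proof.
move=> P0 PD x; rewrite -(tens_reprK x).
elim: (repr x) => [|[a b] s IH]; first by rewrite tens_of0.
by rewrite -cat1s tens_ofD; apply: PD.
Qed.

Lemma tsum_tens (V : zmodType) (f : A -> B -> V) a b :
  balanced f -> tsum f (tensor a b) = f a b.
Proof. by move=> bf; rewrite tsum_of // big_cons big_nil addr0. Qed.

Lemma tsumD (V : zmodType) (f : A -> B -> V) : balanced f ->
  {morph tsum f : x y / x + y}.
Proof.
move=> bf x y; rewrite -(tens_reprK x) -(tens_reprK y) -tens_ofD !tsum_of //.
by rewrite big_cat.
Qed.

Lemma tsum0 (V : zmodType) (f : A -> B -> V) : balanced f -> tsum f 0 = 0.
Proof. by move=> bf; rewrite -tens_of0 tsum_of // big_nil. Qed.

Lemma tsum_semilinear (V : zmodType) (s : V -> V) (f : A -> B -> V) (c : K) :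
    balanced f -> s 0 = 0 -> {morph s : u v / u + v} ->
    (forall a b, f (c *: a) b = s (f a b)) ->
  forall x y, tsum f (c *: x + y) = s (tsum f x) + tsum f y.
Proof.
move=> bf s0 sD fZ x y; rewrite tsumD //; congr (_ + _).
elim/tens_ind: x => [|a b x IH]; first by rewrite scaler0 tsum0.
by rewrite scalerDr -tensorZl !tsumD // !tsum_tens // fZ IH sD.
Qed.

Definition bilin (V : lmodType K) (f : A -> B -> V) :=
  (forall b, linear (f^~ b)) /\ (forall a, linear (f a)).

Lemma bilinP (V : lmodType K) (f : A -> B -> V) : bilin f ->
  balanced f /\ forall c a b, f (c *: a) b = c *: f a b.
Proof.
case=> fl fr; split=> [|c a b]; last exact: (linearPZ (fl b)).
split=> [a a' b|a b b'|c a b]; first exact: (linearPD (fl b)).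
  exact: (linearPD (fr a)).
by rewrite (linearPZ (fr a)); apply: (linearPZ (fl b)).
Qed.

(* the universal property of the tensor product *)
Lemma tsum_linear (V : lmodType K) (f : A -> B -> V) :
  bilin f -> linear (tsum f).
Proof.
move=> /bilinP[bf fZ] c x y.
by apply: (@tsum_semilinear _ ( *:%R c)) => //;
  [rewrite scaler0 | move=> u v; rewrite scalerDr].
Qed.

Lemma tens_linear_ext (V : lmodType K) (f g : tens -> V) :
  linear f -> linear g ->
  (forall a b, f (tensor a b) = g (tensor a b)) -> f =1 g.
Proof.
move=> fl gl fg.
elim/tens_ind => [|a b x IH]; first by rewrite (linearP0 fl) (linearP0 gl).
by rewrite (linearPD fl) (linearPD gl) fg IH.
Qed.

End TensorRel.

Notation "a \ox b" := (tensor a b) (at level 40, left associativity)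
  : nualg_scope.

Section TensorMap.
Variables (K : fieldType) (A B A' B' : lmodType K).

Definition tmap (f : A -> A') (g : B -> B') : tens A B -> tens A' B' :=
  tsum (fun a b => f a \ox g b).

Lemma tmap_bilin (f : A -> A') (g : B -> B') : linear f -> linear g ->
  bilin (fun a b => f a \ox g b).
Proof.
by move=> fl gl; split=> [b c a a'|a c b b'];
  rewrite ?fl ?gl ?tensorDl ?tensorDr ?tensorZl ?tensorZr.
Qed.

Lemma tmap_linear (f : A -> A') (g : B -> B') : linear f -> linear g -> linear (tmap f g).
Proof. by move=> fl gl; apply: tsum_linear; apply: tmap_bilin. Qed.

Lemma tmapE (f : A -> A') (g : B -> B') a b : linear f -> linear g ->
  tmap f g (a \ox b) = f a \ox g b.
Proof.
by move=> fl gl; apply: tsum_tens; have [] := bilinP (tmap_bilin fl gl).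
Qed.

(* (\iota \otimes w) and (w \otimes \iota) *)
Definition slice_r (w : B -> K) : tens A B -> A := tsum (fun a b => w b *: a).
Definition slice_l (w : A -> K) : tens A B -> B := tsum (fun a b => w a *: b).

End TensorMap.

Definition tassoc (K : fieldType) (A B C : lmodType K)
    (x : tens (tens A B) C) : tens A (tens B C) :=
  tsum (fun (y : tens A B) (c : C) => tsum (fun a b => a \ox (b \ox c)) y) x.

Section TensorAlgebra.
Variables (K : fieldType) (A B : nualgType K).
Implicit Types x y z : tens A B.

Definition tens_mul x y : tens A B :=
  tsum (fun a b => tmap (numul a) (numul b) y) x.

Let tmap_numul_linear (a : A) (b : B) : linear (tmap (numul a) (numul b)).
Proof. by apply: tmap_linear; apply: numul_linearr. Qed.

Let tmap_numulE (a : A) (b : B) c d :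
  tmap (numul a) (numul b) (c \ox d) = (a ** c) \ox (b ** d).
Proof. by apply: tmapE; apply: numul_linearr. Qed.

Let tens_mul_bilin y : bilin (fun (a : A) (b : B) => tmap (numul a) (numul b) y).
Proof.
split=> [b|a] k u v; elim/tens_ind: y => [|c d y IH].
- by rewrite !(linearP0 (tmap_numul_linear _ _)) scaler0 addr0.
- rewrite !(linearPD (tmap_numul_linear _ _)) IH !tmap_numulE.
  by rewrite numulDl numulZl tensorDl tensorZl scalerDr addrACA.
- by rewrite !(linearP0 (tmap_numul_linear _ _)) scaler0 addr0.
- rewrite !(linearPD (tmap_numul_linear _ _)) IH !tmap_numulE.
  by rewrite numulDl numulZl tensorDr tensorZr scalerDr addrACA.
Qed.

Lemma tens_mul_linearl y : linear (tens_mul^~ y).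
Proof. exact: tsum_linear. Qed.

Lemma tens_mul_tensorl a b y :
  tens_mul (a \ox b) y = tmap (numul a) (numul b) y.
Proof. by apply: tsum_tens; have [] := bilinP (tens_mul_bilin y). Qed.

Lemma tens_mul_linearr x : linear (tens_mul x).
Proof.
move=> k u v; elim/tens_ind: x => [|a b x IH].
  by rewrite !(linearP0 (tens_mul_linearl _)) scaler0 addr0.
rewrite !(linearPD (tens_mul_linearl _)) IH !tens_mul_tensorl.
by rewrite tmap_numul_linear scalerDr addrACA.
Qed.

Lemma tens_mulE (a c : A) (b d : B) :
  tens_mul (a \ox b) (c \ox d) = (a ** c) \ox (b ** d).
Proof. by rewrite tens_mul_tensorl. Qed.

Lemma tens_mulA : associative tens_mul.
Proof.
have mDl y : {morph tens_mul^~ y : u v / u + v} := linearPD (tens_mul_linearl y).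
have mDr x : {morph tens_mul x : u v / u + v} := linearPD (tens_mul_linearr x).
have m0l y : tens_mul 0 y = 0 := linearP0 (tens_mul_linearl y).
have m0r x : tens_mul x 0 = 0 := linearP0 (tens_mul_linearr x).
move=> x y z; elim/tens_ind: x => [|a b x IHx]; first by rewrite !m0l.
rewrite !mDl IHx; congr (_ + _); elim/tens_ind: y {IHx} => [|c d y IHy].
  by rewrite !(m0l, m0r).
rewrite !(mDl, mDr) IHy; congr (_ + _).
elim/tens_ind: z {IHy} => [|e f z IHz]; first by rewrite !m0r.
by rewrite !mDr IHz !tens_mulE !numulA.
Qed.

HB.instance Definition _ := Lmodule_isNUAlgebra.Build K (tens A B)
  tens_mulA tens_mul_linearl tens_mul_linearr.

Lemma tensM (a c : A) (b d : B) : (a \ox b) ** (c \ox d) = (a ** c) \ox (b ** d).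
Proof. exact: tens_mulE. Qed.

End TensorAlgebra.

Section TensorStar.
Variables (K : numClosedFieldType) (A B : starAlgType K).

Definition tens_star (x : tens A B) : tens A B :=
  tsum (fun a b => star a \ox star b) x.

Let star_balanced : balanced (fun (a : A) (b : B) => star a \ox star b).
Proof.
by split=> [a a' b|a b b'|c a b];
  rewrite ?starD ?tensorDl ?tensorDr // !starZ tensorZl tensorZr.
Qed.

Lemma tens_starZD (c : K) (x y : tens A B) :
  tens_star (c *: x + y) = c^* *: tens_star x + tens_star y.
Proof.
apply: (@tsum_semilinear _ _ _ _ ( *:%R c^*)) => //; first by rewrite scaler0.
  by move=> u v; rewrite scalerDr.
by move=> a b; rewrite starZ tensorZl.
Qed.

Let tens_starD (x y : tens A B) : tens_star (x + y) = tens_star x + tens_star y.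
Proof. exact: tsumD. Qed.

Lemma tens_star_tensor (a : A) (b : B) :
  tens_star (a \ox b) = star a \ox star b.
Proof. exact: tsum_tens. Qed.

Let tens_star0 : tens_star 0 = 0.
Proof. exact: tsum0. Qed.

Lemma tens_starK : involutive tens_star.
Proof.
elim/tens_ind => [|a b x IH]; first by rewrite !tens_star0.
by rewrite !tens_starD IH !tens_star_tensor !starK.
Qed.

Lemma tens_starM (x y : tens A B) :
  tens_star (x ** y) = tens_star y ** tens_star x.
Proof.
elim/tens_ind: x => [|a b x IHx]; first by rewrite numul0l tens_star0 numul0r.
rewrite numulDl !tens_starD numulDr IHx; congr (_ + _).
elim/tens_ind: y {IHx} => [|c d y IHy].
  by rewrite numul0r tens_star0 numul0l.
rewrite numulDr !tens_starD numulDl IHy; congr (_ + _).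
by rewrite tensM !tens_star_tensor tensM !starM.
Qed.

HB.instance Definition _ :=
  NUAlgebra_isStar.Build K (tens A B) tens_starK tens_starM tens_starZD.

End TensorStar.

(******************************************************************************)
(*                         The multiplier algebra                             *)
(******************************************************************************)

(* A multiplier m is given by the maps a |-> m a (lmul) and a |-> a m (rmul). *)
Record multiplier (K : fieldType) (A : nualgType K) := Multiplier {
  lmul : A -> A;
  rmul : A -> A;
  lmul_linear : linear lmul;
  rmul_linear : linear rmul;
  lmulM : forall a b, lmul (a ** b) = lmul a ** b;
  rmulM : forall a b, rmul (a ** b) = a ** rmul b;
  lrmul : forall a b, a ** lmul b = rmul a ** b
}.

Local Obligation Tactic := idtac.

Section Multipliers.
Variables (K : fieldType) (A : nualgType K).
Local Notation M := (multiplier A).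
Implicit Types m n p : M.

HB.instance Definition _ := gen_eqMixin M.
HB.instance Definition _ := gen_choiceMixin M.

HB.instance Definition _ m :=
  GRing.isLinear.Build K A A *:%R (lmul m) (lmul_linear m).
HB.instance Definition _ m :=
  GRing.isLinear.Build K A A *:%R (rmul m) (rmul_linear m).

Lemma multiplier_ext m n : lmul m =1 lmul n -> rmul m =1 rmul n -> m = n.
Proof.
case: m n => l r ? ? ? ? ? [l' r' ? ? ? ? ?] /= /funext el /funext er.
by subst; congr Multiplier; apply: Prop_irrelevance.
Qed.

Program Definition madd m n := @Multiplier K A
  (fun a => lmul m a + lmul n a) (fun a => rmul m a + rmul n a) _ _ _ _ _.
Next Obligation. by move=> m n c u v /=; rewrite !linearP scalerDr addrACA. Qed.
Next Obligation. by move=> m n c u v /=; rewrite !linearP scalerDr addrACA. Qed.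
Next Obligation. by move=> m n a b /=; rewrite !lmulM numulDl. Qed.
Next Obligation. by move=> m n a b /=; rewrite !rmulM numulDr. Qed.
Next Obligation. by move=> m n a b /=; rewrite numulDl numulDr !lrmul. Qed.

Program Definition mscale (k : K) m := @Multiplier K A
  (fun a => k *: lmul m a) (fun a => k *: rmul m a) _ _ _ _ _.
Next Obligation.
by move=> k m c u v /=; rewrite linearP scalerDr !scalerA mulrC.
Qed.
Next Obligation.
by move=> k m c u v /=; rewrite linearP scalerDr !scalerA mulrC.
Qed.
Next Obligation. by move=> k m a b /=; rewrite lmulM numulZl. Qed.
Next Obligation. by move=> k m a b /=; rewrite rmulM numulZr. Qed.
Next Obligation. by move=> k m a b /=; rewrite numulZl numulZr lrmul. Qed.

Program Definition mzero := @Multiplier K A (fun=> 0) (fun=> 0) _ _ _ _ _.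
Next Obligation. by move=> c u v; rewrite scaler0 addr0. Qed.
Next Obligation. by move=> c u v; rewrite scaler0 addr0. Qed.
Next Obligation. by move=> a b /=; rewrite numul0l. Qed.
Next Obligation. by move=> a b /=; rewrite numul0r. Qed.
Next Obligation. by move=> a b /=; rewrite numul0l numul0r. Qed.

Program Definition mmul m n := @Multiplier K A
  (lmul m \o lmul n) (rmul n \o rmul m) _ _ _ _ _.
Next Obligation. by move=> m n c u v /=; rewrite !linearP. Qed.
Next Obligation. by move=> m n c u v /=; rewrite !linearP. Qed.
Next Obligation. by move=> m n a b /=; rewrite !lmulM. Qed.
Next Obligation. by move=> m n a b /=; rewrite !rmulM. Qed.
Next Obligation. by move=> m n a b /=; rewrite !lrmul. Qed.

Definition mone := @Multiplier K A id id
  (fun=> fun _ _ => erefl) (fun=> fun _ _ => erefl)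
  (fun _ _ => erefl) (fun _ _ => erefl) (fun _ _ => erefl).

(* the canonical map A -> M(A), injective when A is non-degenerate *)
Program Definition mult_of (a : A) := @Multiplier K A
  (numul a) (numul^~ a) (numul_linearr a) (numul_linearl a) _ _ _.
Next Obligation. by move=> a x y /=; rewrite numulA. Qed.
Next Obligation. by move=> a x y /=; rewrite numulA. Qed.
Next Obligation. by move=> a x y /=; rewrite numulA. Qed.

Lemma maddA : associative madd.
Proof. by move=> m n p; apply: multiplier_ext => a /=; rewrite addrA. Qed.
Lemma maddC : commutative madd.
Proof. by move=> m n; apply: multiplier_ext => a /=; rewrite addrC. Qed.
Lemma madd0 : left_id mzero madd.
Proof. by move=> m; apply: multiplier_ext => a /=; rewrite add0r. Qed.
Lemma maddN : left_inverse mzero (mscale (-1)) madd.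
Proof.
by move=> m; apply: multiplier_ext => a /=; rewrite scaleN1r addNr.
Qed.
HB.instance Definition _ := GRing.isZmodule.Build M maddA maddC madd0 maddN.

Lemma mscaleA c d m : mscale c (mscale d m) = mscale (c * d) m.
Proof. by apply: multiplier_ext => a /=; rewrite scalerA. Qed.
Lemma mscale1 : left_id 1 mscale.
Proof. by move=> m; apply: multiplier_ext => a /=; rewrite scale1r. Qed.
Lemma mscaleDr : right_distributive mscale +%R.
Proof. by move=> c m n; apply: multiplier_ext => a /=; rewrite scalerDr. Qed.
Lemma mscaleDl m : {morph mscale^~ m : c d / c + d}.
Proof. by move=> c d; apply: multiplier_ext => a /=; rewrite scalerDl. Qed.
HB.instance Definition _ := GRing.Zmodule_isLmodule.Build K M
  mscaleA mscale1 mscaleDr mscaleDl.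

Lemma mmulA : associative mmul.
Proof. by move=> m n p; apply: multiplier_ext. Qed.
Lemma mmul_linearl n : linear (mmul^~ n).
Proof. by move=> c m p; apply: multiplier_ext => a //=; rewrite linearP. Qed.
Lemma mmul_linearr m : linear (mmul m).
Proof. by move=> c n p; apply: multiplier_ext => a //=; rewrite linearP. Qed.
HB.instance Definition _ := Lmodule_isNUAlgebra.Build K M
  mmulA mmul_linearl mmul_linearr.

Definition in_alg m := exists x : A, m = mult_of x.

(* the element of A equal to m; only meaningful when in_alg m holds and A is  *)
(* non-degenerate                                                             *)
Definition alg_of m : A := xget 0 [set x | m = mult_of x].

End Multipliers.

Arguments mone {K A}.

Section MultiplierStar.
Variables (K : numClosedFieldType) (A : starAlgType K).
Local Notation M := (multiplier A).

Program Definition mstar (m : M) := @Multiplier K A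
  (fun a => star (rmul m (star a))) (fun a => star (lmul m (star a))) _ _ _ _ _.
Next Obligation.
by move=> m c u v /=; rewrite starZD linearP starZD conjCK.
Qed.
Next Obligation.
by move=> m c u v /=; rewrite starZD linearP starZD conjCK.
Qed.
Next Obligation. by move=> m a b /=; rewrite starM rmulM starM starK. Qed.
Next Obligation. by move=> m a b /=; rewrite starM lmulM starM starK. Qed.
Next Obligation.
by move=> m a b /=; rewrite -[in LHS](starK a) -starM -lrmul starM starK.
Qed.

Lemma mstarK : involutive mstar.
Proof. by move=> m; apply: multiplier_ext => a /=; rewrite !starK. Qed.
Lemma mstarM (m n : M) : mstar (m ** n) = mstar n ** mstar m.
Proof. by apply: multiplier_ext => a /=; rewrite !starK. Qed.
Lemma mstarZD (c : K) (m n : M) :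
  mstar (c *: m + n) = c^* *: mstar m + mstar n.
Proof. by apply: multiplier_ext => a /=; rewrite starZD. Qed.

HB.instance Definition _ := NUAlgebra_isStar.Build K M mstarK mstarM mstarZD.
End MultiplierStar.

Section MultiplierTensor.
Variables (K : fieldType) (A B : nualgType K).

Lemma tmap_lmulM (f : A -> A) (g : B -> B) : linear f -> linear g ->
  (forall a b, f (a ** b) = f a ** b) -> (forall a b, g (a ** b) = g a ** b) ->
  forall x y, tmap f g (x ** y) = tmap f g x ** y.
Proof.
move=> fl gl fM gM; have tl := tmap_linear fl gl.
elim/tens_ind => [|a b x IHx] y; first by rewrite (linearP0 tl) !numul0l (linearP0 tl).
rewrite numulDl !(linearPD tl) numulDl IHx; congr (_ + _).
elim/tens_ind: y => [|c d y IHy]; first by rewrite !numul0r (linearP0 tl).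
by rewrite !numulDr !(linearPD tl) IHy tensM !tmapE // tensM fM gM.
Qed.

Lemma tmap_rmulM (f : A -> A) (g : B -> B) : linear f -> linear g ->
  (forall a b, f (a ** b) = a ** f b) -> (forall a b, g (a ** b) = a ** g b) ->
  forall x y, tmap f g (x ** y) = x ** tmap f g y.
Proof.
move=> fl gl fM gM; have tl := tmap_linear fl gl.
elim/tens_ind => [|a b x IHx] y; first by rewrite !numul0l (linearP0 tl).
rewrite !numulDl !(linearPD tl) IHx; congr (_ + _).
elim/tens_ind: y => [|c d y IHy]; first by rewrite (linearP0 tl) !numul0r (linearP0 tl).
by rewrite !numulDr !(linearPD tl) numulDr IHy tensM !tmapE // tensM fM gM.
Qed.

(* m \otimes n, as an element of M(A \otimes B) *)
Program Definition mtens (m : multiplier A) (n : multiplier B) :=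
  @Multiplier K (tens A B) (tmap (lmul m) (lmul n)) (tmap (rmul m) (rmul n))
    (tmap_linear (lmul_linear m) (lmul_linear n))
    (tmap_linear (rmul_linear m) (rmul_linear n))
    (tmap_lmulM (lmul_linear m) (lmul_linear n) (lmulM m) (lmulM n))
    (tmap_rmulM (rmul_linear m) (rmul_linear n) (rmulM m) (rmulM n)) _.
Next Obligation.
move=> m n x y /=.
have ll := tmap_linear (lmul_linear m) (lmul_linear n).
have rl := tmap_linear (rmul_linear m) (rmul_linear n).
elim/tens_ind: x => [|a b x IHx]; first by rewrite (linearP0 rl) !numul0l.
rewrite (linearPD rl) !numulDl IHx; congr (_ + _).
elim/tens_ind: y {IHx} => [|c d y IHy]; first by rewrite (linearP0 ll) !numul0r.
rewrite (linearPD ll) !numulDr IHy; congr (_ + _).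
by rewrite !tmapE ?tensM ?lrmul //; (apply: lmul_linear || apply: rmul_linear).
Qed.

End MultiplierTensor.

(******************************************************************************)
(*                     Algebraic quantum hypergroups                          *)
(******************************************************************************)

Section Comultiplication.
Variables (K : fieldType) (D : nualgType K).
Local Notation DD := (tens D D).
Variable Delta : {linear D -> multiplier DD}.

(* 1 \otimes b and a \otimes 1 in M(D \otimes D) *)
Local Notation one_tens b := (@mtens K D D mone (mult_of b)).
Local Notation tens_one a := (@mtens K D D (mult_of a) mone).

(* Delta \otimes \iota and \iota \otimes Delta on D \otimes D *)
Definition comul_l (x : DD) : multiplier (tens DD D) :=
  tsum (fun a b => mtens (Delta a) (mult_of b)) x.
Definition comul_r (x : DD) : multiplier (tens D DD) :=
  tsum (fun a b => mtens (mult_of a) (Delta b)) x.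

(* equality of multipliers under (D \ox D) \ox D = D \ox (D \ox D) *)
Definition assoc_eq (m : multiplier (tens DD D)) (n : multiplier (tens D DD)) :=
  forall x, tassoc (lmul m x) = lmul n (tassoc x) /\
            tassoc (rmul m x) = rmul n (tassoc x).

Definition coassociative := forall a b c : D,
  assoc_eq
    (mtens (tens_one c) mone ** comul_l (alg_of (Delta a ** one_tens b)))
    (comul_r (alg_of (tens_one c ** Delta a)) ** mtens mone (one_tens b)).

(* For m in M(D \otimes D) and n in M(D): (w \otimes \iota) m = n, resp.      *)
(* (\iota \otimes w) m = n, as an equality of multipliers of D.               *)
Definition mslice_l (w : {scalar D}) (m : multiplier DD) (n : multiplier D) :=
  forall b, slice_l w (alg_of (m ** one_tens b)) = lmul n b /\
            slice_l w (alg_of (one_tens b ** m)) = rmul n b.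
Definition mslice_r (w : {scalar D}) (m : multiplier DD) (n : multiplier D) :=
  forall b, slice_r w (alg_of (m ** tens_one b)) = lmul n b /\
            slice_r w (alg_of (tens_one b ** m)) = rmul n b.

Definition left_invariant (phi : {scalar D}) :=
  forall a, mslice_r phi (Delta a) (phi a *: mone).

Definition faithful (phi : {scalar D}) := forall b : D,
  (forall a, phi (a ** b) = 0) \/ (forall a, phi (b ** a) = 0) -> b = 0.

Definition is_counit (eps : {scalar D}) :=
  (forall a b, eps (a ** b) = eps a * eps b) /\
  (forall a, mslice_l eps (Delta a) (mult_of a) /\
             mslice_r eps (Delta a) (mult_of a)).

Definition is_antipode (phi : {scalar D}) (S : {linear D -> D}) :=
  [/\ bijective S,
      forall a b, S (a ** b) = S b ** S a &
      forall a b, S (slice_r phi (alg_of (Delta a ** one_tens b))) =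
                  slice_r phi (alg_of (one_tens a ** Delta b))].

Definition quantum_hypergroup :=
  [/\ nondegenerate D,
      forall a b, [/\ in_alg (Delta a ** one_tens b),
                      in_alg (tens_one a ** Delta b),
                      in_alg (Delta a ** tens_one b) &
                      in_alg (one_tens a ** Delta b)],
      coassociative,
      exists eps : {scalar D}, is_counit eps &
      exists phi : {scalar D}, [/\ faithful phi, left_invariant phi &
        exists S : {linear D -> D}, is_antipode phi S]].

Definition quantum_hypergroup_compact_type :=
  quantum_hypergroup /\ exists e : D, is_identity e.

End Comultiplication.

(******************************************************************************)
(*        Multiplier Hopf star-algebras and algebraic quantum groups          *)
(******************************************************************************)

Section QuantumGroup.
Variables (K : numClosedFieldType) (A : starAlgType K).
Variable Delta : {linear A -> multiplier (tens A A)}.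

Definition star_homomorphism :=
  (forall a b, Delta (a ** b) = Delta a ** Delta b) /\
  (forall a, Delta (star a) = star (Delta a)).

(* Delta(A)(A \otimes A) = A \otimes A = (A \otimes A)Delta(A) *)
Definition nondegenerate_map := forall y : tens A A,
  (exists s : seq (A * tens A A), y = \sum_(p <- s) lmul (Delta p.1) p.2) /\
  (exists s : seq (A * tens A A), y = \sum_(p <- s) rmul (Delta p.1) p.2).

Definition multiplier_hopf_star :=
  [/\ nondegenerate A, star_homomorphism, nondegenerate_map, coassociative Delta &
      (exists T : {linear tens A A -> tens A A}, bijective T /\
         forall a b, mult_of (T (a \ox b)) = Delta a ** mtens mone (mult_of b)) /\
      (exists T : {linear tens A A -> tens A A}, bijective T /\
         forall a b, mult_of (T (a \ox b)) = mtens (mult_of a) mone ** Delta b)].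

Definition positive_left_integral (phi : {scalar A}) :=
  [/\ exists a, phi a != 0, forall a, 0 <= phi (star a ** a) &
      left_invariant Delta phi].

Definition algebraic_quantum_group :=
  multiplier_hopf_star /\ exists phi : {scalar A}, positive_left_integral phi.

Definition group_like_projection (h : A) :=
  [/\ h != 0, h ** h = h, star h = h &
      Delta h ** mtens mone (mult_of h) = mult_of (h \ox h)].

End QuantumGroup.

(******************************************************************************)
(*                            The corner h A h                                *)
(******************************************************************************)

Section Corner.
Variables (K : fieldType) (A : nualgType K) (h : A).

Definition corner_pred : {pred A} := fun x => `[< exists a, x = h ** a ** h >].

Lemma corner_submod : submod_closed corner_pred.
Proof.
split=> [|c x y /asboolP[a ->] /asboolP[b ->]]; apply/asboolP.
  by exists 0; rewrite numul0r numul0l.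
by exists (c *: a + b); rewrite numulDr numulZr numulDl numulZl.
Qed.
HB.instance Definition _ := GRing.isSubmodClosed.Build K A corner_pred corner_submod.

Definition corner := {x : A | corner_pred x}.
HB.instance Definition _ := SubChoice.on corner.
HB.instance Definition _ := [SubChoice_isSubLmodule of corner by <:].

Lemma corner_mul_subproof (x y : corner) : corner_pred (val x ** val y).
Proof.
case: x y => [x /= /asboolP[a ->]] [y /= /asboolP[b ->]]; apply/asboolP.
by exists (a ** h ** h ** b); rewrite !numulA.
Qed.
Definition corner_mul (x y : corner) : corner :=
  exist _ (val x ** val y) (corner_mul_subproof x y).

Lemma corner_mulA : associative corner_mul.
Proof. by move=> x y z; apply: val_inj; apply: numulA. Qed.
Lemma corner_mul_linearl y : linear (corner_mul^~ y).
Proof. by move=> c u v; apply: val_inj; apply: numul_linearl. Qed.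
Lemma corner_mul_linearr x : linear (corner_mul x).
Proof. by move=> c u v; apply: val_inj; apply: numul_linearr. Qed.
HB.instance Definition _ := Lmodule_isNUAlgebra.Build K corner
  corner_mulA corner_mul_linearl corner_mul_linearr.

(* the inclusion of hAh \otimes hAh in A \otimes A *)
Definition corner_tens_val : tens corner corner -> tens A A := tmap val val.

(* Delta0(a) = (h \otimes h) Delta(a) (h \otimes h): the right-hand side is a *)
(* multiplier of A \otimes A and Delta0 a one of hAh \otimes hAh, and both    *)
(* are required to be given by the same element of hAh \otimes hAh.           *)
Definition corner_comul (Delta : {linear A -> multiplier (tens A A)})
    (Delta0 : {linear corner -> multiplier (tens corner corner)}) :=
  forall a : corner, exists y : tens corner corner,
    Delta0 a = mult_of y /\
    mult_of (corner_tens_val y) =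
      mult_of (h \ox h) ** Delta (val a) ** mult_of (h \ox h).

End Corner.

(* Main.v *)
(* Let phi be the left integral, T1(a # b) = Delta(a)(1 # b),
   F(a # b) = (iota # phi)(Delta(a)(1 # b)) and
   G(a # b) = (iota # phi)((1 # a)Delta(b)), where # is the tensor product.
   Left invariance gives, in Sweedler notation,
     T1^-1(F(a # b) # d) = a_1 # b_1 d phi(a_2 b_2),
   and F is onto, so the counit and the antipode of A can be read off T1^-1:
   multiplying the legs shows that m(T1^-1(z # d)) = eps(z) d with
   eps(F(a # b)) = phi(a b), and then S(z) d = (eps # iota) T1^-1(z # d) with
   S(F(a # b)) = G(a # b).  From these follow the faithfulness of phi, S(h) = h
   and, comparing S(F(h # b) h) with S(F(h # h b)), the identity
   Delta(h)(h # 1) = h # h.  Hence, for a in hAh,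
     (h # h)Delta(a)(h # h) = (h # 1)Delta(a)(h # 1),
   and the counit, the integral and the antipode of A restrict to hAh. *)
Require Import Defs.
From HB Require Import structures.
From mathcomp Require Import all_boot all_order all_algebra.
From mathcomp Require Import boolp classical_sets reals.
From mathcomp Require Import complex.
From mathcomp Require Import ring.

Set Implicit Arguments.
Unset Strict Implicit.
Unset Printing Implicit Defensive.

Import Order.TTheory GRing.Theory Num.Theory.
Local Open Scope ring_scope.
Local Open Scope nualg_scope.

(** * Linear functionals that detect non-zero vectors *)

Section LinearFunctionals.
Variables (K : fieldType) (V W : lmodType K).

Lemma linear_pack (f : V -> W) : linear f -> exists g : {linear V -> W}, g =1 f.
Proof.
move=> fl; pose m := GRing.isLinear.Build K V W *:%R f fl.
by pose g : {linear V -> W} := HB.pack f m; exists g.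
Qed.

Lemma scalar_pack (f : V -> K) : scalar f -> exists g : {scalar V}, g =1 f.
Proof.
move=> fl; pose m := GRing.isLinear.Build K V K *%R f fl.
by pose g : {scalar V} := HB.pack f m; exists g.
Qed.

(* For a maximal subspace U avoiding v, every vector is u + k v with u in U and
   a unique k; the functional is x |-> k. *)
Lemma exists_functional (v : V) : v != 0 -> exists f : {scalar V}, f v = 1.
Proof.
move=> v0.
pose P (U : set V) := (forall k x y, U x -> U y -> U (k *: x + y)) /\ ~ U v.
have [|U [[UP Uv] Umax]] := @Zorn_bigcup V P.
  move=> F FP Ftot; split=> [k x y [X FX Xx] [Y FY Yy]|[X FX Xv]]; last first.
    by have [_] := FP _ FX.
  have [XY|YX] := Ftot _ _ FX FY.
    by exists Y => //; apply: (FP _ FY).1 => //; apply: XY.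
  by exists X => //; apply: (FP _ FX).1 => //; apply: YX.
(* [P] does not ask for 0; but if 0 were missing, [U] would be empty and {0} a larger admissible
   set. *)
have U0 : U 0.
  apply: contrapT => nU0; apply: (Umax [set 0]%classic).
    split=> [x Ux|/(_ 0 erefl)//]; case: nU0.
    by have := UP (-1) _ _ Ux Ux; rewrite scaleN1r addNr.
  split=> [k x y -> ->|/= v00]; first by rewrite scaler0 addr0.
  by rewrite v00 eqxx in v0.
have UZ k x : U x -> U (k *: x) by move=> Ux; rewrite -[_ *: _]addr0; apply: UP.
(* Otherwise U + K x would still avoid [v] and strictly contain [U]. *)
have dec x : exists k, U (x - k *: v).
  apply: contrapT => xU.
  pose B : set V := [set y | exists k u, U u /\ y = u + k *: x]%classic.
  apply: (Umax B); [split=> [u Uu|BU]|split=> [k y z|]].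
  - by exists 0, u; rewrite scale0r addr0.
  - case: xU; exists 0; rewrite scale0r subr0; apply: BU.
    by exists 1, 0; rewrite scale1r add0r.
  - move=> [c [u [Uu ->]]] [d [w [Uw ->]]]; exists (k * c + d), (k *: u + w).
    split; first exact: UP.
    by rewrite scalerDr scalerA scalerDl addrACA.
  - move=> [k [u [Uu vE]]]; have [k0|k0] := eqVneq k 0.
      by apply: Uv; rewrite vE k0 scale0r addr0.
    apply: xU; exists k^-1; rewrite {1}vE scalerDr scalerA mulVf // scale1r.
    by rewrite opprD addrC subrK -scaleNr; apply: UZ.
have uniq x k l : U (x - k *: v) -> U (x - l *: v) -> k = l.
  move=> Uk Ul; apply/eqP; rewrite -subr_eq0; apply: contrapT => /negP kl.
  apply: Uv; rewrite -[v]scale1r -(mulVf kl) -scalerA; apply: UZ.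
  rewrite scalerBl; have -> : k *: v - l *: v = -1 *: (x - k *: v) + (x - l *: v).
    by rewrite scaleN1r opprB addrA subrK.
  exact: UP.
have [f fP] := choice dec.
have fl : scalar f.
  move=> k x y; apply: uniq (fP _) _.
  have -> : k *: x + y - (k * f x + f y) *: v =
            k *: (x - f x *: v) + (y - f y *: v).
    by rewrite scalerDl opprD addrACA scalerBr scalerA.
  exact: UP.
have [g gE] := scalar_pack fl; exists g; rewrite gE.
by apply: uniq (fP v) _; rewrite scale1r subrr.
Qed.

End LinearFunctionals.

(** * Tensoring, slicing and flipping as linear maps *)

Section TensorLinear.
Variables (K : fieldType).

Section Pair.
Variables (A B : lmodType K).

HB.instance Definition _ (a : A) :=
  GRing.isLinear.Build K B (tens A B) *:%R (tensor a)
    (fun k x y => etrans (tensorDr a (k *: x) y)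
                         (congr1 (+%R^~ _) (tensorZr k a x))).

Definition tensorl (b : B) (a : A) : tens A B := a \ox b.
Lemma tensorl_linear b : linear (tensorl b).
Proof. by move=> k x y; rewrite /tensorl tensorDl tensorZl. Qed.
HB.instance Definition _ (b : B) :=
  GRing.isLinear.Build K A (tens A B) *:%R (tensorl b) (tensorl_linear b).

Lemma tensor0l (b : B) : (0 : A) \ox b = 0.
Proof. exact: (linear0 (tensorl b)). Qed.

Lemma slice_r_bilin (w : {scalar B}) : bilin (fun (a : A) b => w b *: a).
Proof.
split=> [b|a] k x y; first by rewrite scalerDr !scalerA mulrC.
by rewrite linearP scalerDl scalerA.
Qed.
Lemma slice_l_bilin (w : {scalar A}) : bilin (fun a (b : B) => w a *: b).
Proof.
split=> [b|a] k x y; first by rewrite linearP scalerDl scalerA.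
by rewrite scalerDr !scalerA mulrC.
Qed.
HB.instance Definition _ (w : {scalar B}) :=
  GRing.isLinear.Build K (tens A B) A *:%R (@slice_r K A B w)
    (tsum_linear (slice_r_bilin w)).
HB.instance Definition _ (w : {scalar A}) :=
  GRing.isLinear.Build K (tens A B) B *:%R (@slice_l K A B w)
    (tsum_linear (slice_l_bilin w)).

Lemma slice_rE (w : {scalar B}) (a : A) b : slice_r w (a \ox b) = w b *: a.
Proof. by apply: tsum_tens; have [] := bilinP (slice_r_bilin w). Qed.
Lemma slice_lE (w : {scalar A}) a (b : B) : slice_l w (a \ox b) = w a *: b.
Proof. by apply: tsum_tens; have [] := bilinP (slice_l_bilin w). Qed.

Definition tswap (x : tens A B) : tens B A := tsum (fun a b => b \ox a) x.
Lemma tswap_bilin : bilin (fun (a : A) (b : B) => b \ox a).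
Proof.
by split=> [b|a] k x y; rewrite ?tensorDl ?tensorDr ?tensorZl ?tensorZr.
Qed.
HB.instance Definition _ :=
  GRing.isLinear.Build K (tens A B) (tens B A) *:%R tswap
    (tsum_linear tswap_bilin).
Lemma tswapE (a : A) (b : B) : tswap (a \ox b) = b \ox a.
Proof. by apply: tsum_tens; have [] := bilinP tswap_bilin. Qed.

Variables (A' B' : lmodType K).
HB.instance Definition _ (f : {linear A -> A'}) (g : {linear B -> B'}) :=
  GRing.isLinear.Build K (tens A B) (tens A' B') *:%R (tmap f g)
    (tmap_linear (@linearP _ _ _ _ f) (@linearP _ _ _ _ g)).

End Pair.
End TensorLinear.

Section RightMultiplication.
Variables (K : fieldType) (A : nualgType K).
(** A named constant, so that right multiplication can carry a linear structure. *)
Definition numulr (b x : A) := x ** b.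
HB.instance Definition _ (b : A) :=
  GRing.isLinear.Build K A A *:%R (numulr b) (numul_linearl b).
End RightMultiplication.

(** * Non-degeneracy of the tensor product of two algebras *)

Section TensorNondegenerate.
Variable (K : fieldType).

Lemma tens_ofE (A B : lmodType K) (s : seq (A * B)) :
  tens_of s = \sum_(p <- s) p.1 \ox p.2.
Proof.
elim: s => [|[a b] s IH]; first by rewrite big_nil tens_of0.
by rewrite big_cons -cat1s tens_ofD IH.
Qed.

(* A representation of minimal length: a relation slice_r w x = 0 with w q != 0
   would express the partner of q through the other left legs. *)
Lemma tens_indep_rep (A B : lmodType K) (x : tens A B) :
  exists2 s : seq (A * B), x = \sum_(p <- s) p.1 \ox p.2 &
    forall w : {scalar B}, slice_r w x = 0 -> forall p, p \in s -> w p.2 = 0.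
Proof.
have [n] : exists n, exists2 s : seq (A * B), size s = n & x = tens_of s.
  by exists (size (repr x)), (repr x); first by []; rewrite tens_reprK.
elim: n => [|n IH] [s sz xE].
  by exists s; [rewrite xE tens_ofE | rewrite (size0nil sz)].
have [//|noRep] := EM (exists2 s : seq (A * B), x = \sum_(p <- s) p.1 \ox p.2 &
  forall w : {scalar B}, slice_r w x = 0 -> forall p, p \in s -> w p.2 = 0).
apply: IH.
have [w [p [w0 ps wp]]] : exists w : {scalar B}, exists p,
    [/\ slice_r w x = 0, p \in s & w p.2 != 0].
  apply: contrapT => H; apply: noRep; exists s; first by rewrite xE tens_ofE.
  move=> w w0 p ps; apply: contrapT => /eqP wp.
  by apply: H; exists w, p.
(* The relation [slice_r w x = 0] gives [p.1] as minus the sum of the (w q.2 / w p.2) q.1 over the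
   other q; substituting it leaves one term fewer. *)
exists [seq (q.1, q.2 - (w q.2 / w p.2) *: p.2) | q <- rem p s].
  by rewrite size_map size_rem // sz.
rewrite tens_ofE big_map /=.
under eq_bigr => q _ do rewrite linearB /= tensorZr -tensorZl.
rewrite sumrB /= xE tens_ofE (perm_big _ (perm_to_rem ps)) big_cons /=.
rewrite addrC; congr (_ + _).
rewrite -(linear_sum (tensorl p.2)) /= -linearN /=.
congr (_ \ox _); apply/eqP; rewrite -addr_eq0; apply/eqP.
have : (w p.2)^-1 *: slice_r w x = 0 by rewrite w0 scaler0.
rewrite xE tens_ofE (perm_big _ (perm_to_rem ps)) big_cons /= !linearD /=.
rewrite slice_rE scalerA mulVf // scale1r => rel0; rewrite -[RHS]rel0.
congr (_ + _); rewrite (linear_sum (slice_r w)) scaler_sumr.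
apply: eq_bigr => q _ /=.
by rewrite slice_rE scalerA mulrC.
Qed.

Lemma functional_eq0 (V : lmodType K) (v : V) :
  (forall w : {scalar V}, w v = 0) -> v = 0.
Proof.
move=> v0; apply: contrapT => /eqP /exists_functional[f].
by rewrite v0 => /esym/eqP; rewrite oner_eq0.
Qed.

Lemma mult_of_inj (A : nualgType K) :
  Defs.nondegenerate A -> injective (@mult_of K A).
Proof.
move=> [nl _] a b ab; apply/eqP; rewrite -subr_eq0; apply/eqP; apply: nl => c.
rewrite numulDl -scaleN1r numulZl scaleN1r.
by have /= -> := congr1 (fun m => lmul m c) ab; rewrite subrr.
Qed.

Lemma slice_r_mult_l (A B : nualgType K) (w : {scalar B}) b (x : tens A B) a :
  slice_r w (x ** (a \ox b)) = slice_r (w \o numulr b) x ** a.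
Proof.
elim/tens_ind: x => [|c d x IH]; first by rewrite numul0l !linear0 numul0l.
by rewrite numulDl !linearD /= numulDl IH tensM !slice_rE numulZl.
Qed.

Lemma slice_r_mult_r (A B : nualgType K) (w : {scalar B}) b (x : tens A B) a :
  slice_r w ((a \ox b) ** x) = a ** slice_r (w \o numul b) x.
Proof.
elim/tens_ind: x => [|c d x IH]; first by rewrite !linear0.
by rewrite !linearD /= IH tensM !slice_rE numulZr.
Qed.

(** If x annihilates all a # b from one side, its slice by the functional w(. b), resp. w(b .),
    annihilates A and is therefore 0. For the representation of [tens_indep_rep] this functional
    kills every second leg; as w and b vary, the second legs vanish. *)
Lemma tens_nondegenerate (A B : nualgType K) :
  Defs.nondegenerate A -> Defs.nondegenerate B -> Defs.nondegenerate (tens A B).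
Proof.
move=> [Al Ar] [Bl Br]; split=> x x0.
  have [s xE sP] := tens_indep_rep x; rewrite xE big_seq big1 // => p ps.
  rewrite [p.2]Bl ?linear0 // => b; apply: functional_eq0 => w.
  apply: (sP (w \o numulr b)) => //; apply: Al => a.
  by rewrite -slice_r_mult_l x0 linear0.
have [s xE sP] := tens_indep_rep x; rewrite xE big_seq big1 // => p ps.
rewrite [p.2]Br ?linear0 // => b; apply: functional_eq0 => w.
apply: (sP (w \o numul b)) => //; apply: Ar => a.
by rewrite -slice_r_mult_r x0 linear0.
Qed.

End TensorNondegenerate.

(** * Functoriality, associativity and the product map on tensors *)

Section TensorMaps.
Variable (K : fieldType).

Lemma tmap_tensor (A B A' B' : lmodType K) (f : {linear A -> A'})
    (g : {linear B -> B'}) a b :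
  tmap f g (a \ox b) = f a \ox g b.
Proof. by apply: tmapE; apply: linearP. Qed.

Lemma tmap_comp (A B A' B' A'' B'' : lmodType K)
    (f : {linear A -> A'}) (g : {linear B -> B'})
    (f' : {linear A' -> A''}) (g' : {linear B' -> B''}) x :
  tmap f' g' (tmap f g x) = tmap (f' \o f) (g' \o g) x.
Proof.
elim/tens_ind: x => [|a b x IH]; first by rewrite !linear0.
by rewrite !linearD /= IH !tmap_tensor.
Qed.

Lemma eq_tmap (A B A' B' : lmodType K)
    (f f' : {linear A -> A'}) (g g' : {linear B -> B'}) :
  f =1 f' -> g =1 g' -> tmap f g =1 tmap f' g'.
Proof.
move=> ff gg; elim/tens_ind => [|a b x IH]; first by rewrite !linear0.
by rewrite !linearD /= IH !tmap_tensor ff gg.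
Qed.

Section Assoc.
Variables (A B C : lmodType K).

Lemma tassoc_bilin1 (c : C) :
  bilin (fun (a : A) (b : B) => a \ox (b \ox c)).
Proof.
split=> [b|a] k x y; first by rewrite tensorDl tensorZl.
by rewrite tensorDl tensorDr tensorZl tensorZr.
Qed.

Lemma tassoc_bilin :
  bilin (fun (y : tens A B) (c : C) => tsum (fun a b => a \ox (b \ox c)) y).
Proof.
split=> [c|y k c d]; first exact: tsum_linear (tassoc_bilin1 c).
elim/tens_ind: y => [|a b y IH].
  by rewrite !(linearP0 (tsum_linear (tassoc_bilin1 _))) scaler0 addr0.
rewrite !(linearPD (tsum_linear (tassoc_bilin1 _))) IH.
have tE (c' : C) : tsum (fun (a : A) (b : B) => a \ox (b \ox c')) (a \ox b) =
    a \ox (b \ox c').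
  by apply: tsum_tens; have [] := bilinP (tassoc_bilin1 c').
by rewrite !tE !linearP /= scalerDr addrACA.
Qed.

HB.instance Definition _ :=
  GRing.isLinear.Build K (tens (tens A B) C) (tens A (tens B C)) *:%R
    (@tassoc K A B C) (tsum_linear tassoc_bilin).

Lemma tassocE (a : A) (b : B) (c : C) :
  tassoc ((a \ox b) \ox c) = a \ox (b \ox c).
Proof.
rewrite /tassoc tsum_tens; last by have [] := bilinP tassoc_bilin.
by apply: tsum_tens; have [] := bilinP (tassoc_bilin1 c).
Qed.

End Assoc.

Lemma tassoc_tmap (A B C A' B' C' : lmodType K) (f : {linear A -> A'})
    (g : {linear B -> B'}) (k : {linear C -> C'}) x :
  tassoc (tmap (tmap f g) k x) = tmap f (tmap g k) (tassoc x).
Proof.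
elim/tens_ind: x => [|y c x IH]; first by rewrite !linear0.
rewrite !linearD /= IH; congr (_ + _); rewrite tmap_tensor /=.
elim/tens_ind: y => [|a b y IHy].
  by rewrite linear0 !tensor0l !linear0.
rewrite linearD /= !tensorDl !linearD /= IHy.
by rewrite /= !(tmap_tensor, tassocE) /= tmap_tensor.
Qed.

Lemma tmap_slice_assoc (A B C : lmodType K) (w : {scalar C})
    (x : tens (tens A B) C) :
  tmap idfun (slice_r w) (tassoc x) = slice_r w x.
Proof.
elim/tens_ind: x => [|y c x IH]; first by rewrite !linear0.
rewrite !linearD /= IH; congr (_ + _); rewrite slice_rE.
elim/tens_ind: y => [|a b y IHy]; first by rewrite tensor0l !linear0.
rewrite tensorDl !linearD /= IHy; congr (_ + _).
by rewrite tassocE tmap_tensor /= slice_rE linearZ.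
Qed.

Section Product.
Variable A : nualgType K.
Definition tens_prod (x : tens A A) : A := tsum numul x.
Lemma numul_bilin : bilin (@numul K A).
Proof. by split; [apply: numul_linearl | apply: numul_linearr]. Qed.
HB.instance Definition _ :=
  GRing.isLinear.Build K (tens A A) A *:%R tens_prod (tsum_linear numul_bilin).
Lemma tens_prodE a b : tens_prod (a \ox b) = a ** b.
Proof. by apply: tsum_tens; have [] := bilinP numul_bilin. Qed.
End Product.

Lemma slice_r_tmap (A B A' B' : lmodType K) (w : {scalar B'})
    (f : {linear A -> A'}) (g : {linear B -> B'}) x :
  slice_r w (tmap f g x) = f (slice_r (w \o g) x).
Proof.
elim/tens_ind: x => [|a b x IH]; first by rewrite !linear0.
by rewrite !linearD /= IH tmap_tensor !slice_rE linearZ.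
Qed.

Lemma eq_slice_r (A B : lmodType K) (w w' : {scalar B}) (x : tens A B) :
  w =1 w' -> slice_r w x = slice_r w' x.
Proof.
move=> ww; elim/tens_ind: x => [|a b x IH]; first by rewrite !linear0.
by rewrite !linearD /= IH !slice_rE ww.
Qed.

Lemma eq_slice_l (A B : lmodType K) (w w' : {scalar A}) (x : tens A B) :
  w =1 w' -> slice_l w x = slice_l w' x.
Proof.
move=> ww; elim/tens_ind: x => [|a b x IH]; first by rewrite !linear0.
by rewrite !linearD /= IH !slice_lE ww.
Qed.

Lemma slice_l_tmap (A B A' B' : lmodType K) (w : {scalar A'})
    (f : {linear A -> A'}) (g : {linear B -> B'}) x :
  slice_l w (tmap f g x) = g (slice_l (w \o f) x).
Proof.
elim/tens_ind: x => [|a b x IH]; first by rewrite !linear0.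
by rewrite !linearD /= IH tmap_tensor !slice_lE linearZ.
Qed.

Lemma tassocM (A B C : nualgType K) (x y : tens (tens A B) C) :
  tassoc (x ** y) = tassoc x ** tassoc y.
Proof.
elim/tens_ind: x => [|x c x' IH]; first by rewrite numul0l !linear0 numul0l.
rewrite numulDl !linearD /= numulDl IH; congr (_ + _) => {x' IH}.
elim/tens_ind: x => [|a b x IH]; first by rewrite tensor0l numul0l !linear0 numul0l.
rewrite tensorDl numulDl !linearD /= numulDl IH; congr (_ + _) => {x IH}.
elim/tens_ind: y => [|y c' y' IH]; first by rewrite !linear0.
rewrite !linearD /= IH; congr (_ + _) => {y' IH}.
elim/tens_ind: y => [|a' b' y IH]; first by rewrite !(tensor0l, linear0).
by rewrite tensorDl !linearD /= IH; congr (_ + _); rewrite !(tensM, tassocE).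
Qed.

End TensorMaps.

(** * Elements of an algebra among its multipliers *)

Section MultiplierElements.
Variable (K : fieldType).

Section One.
Variable A : nualgType K.
Implicit Types m n : multiplier A.

Lemma mult_of_linear : linear (@mult_of K A).
Proof.
move=> k a b; apply: multiplier_ext => x /=; first by rewrite numulDl numulZl.
by rewrite linearP.
Qed.
HB.instance Definition _ :=
  GRing.isLinear.Build K A (multiplier A) *:%R (@mult_of K A) mult_of_linear.

Lemma mult_ofM (a b : A) : mult_of (a ** b) = mult_of a ** mult_of b.
Proof. by apply: multiplier_ext => x /=; rewrite numulA. Qed.

(** With [mult_of_rmul], this makes A an ideal of M(A): identities between elements can be checked
    as products of multipliers and pulled back by injectivity of [mult_of]. *)
Lemma mult_of_lmul m a : mult_of (lmul m a) = m ** mult_of a.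
Proof. by apply: multiplier_ext => x /=; rewrite ?lmulM ?lrmul. Qed.

Lemma mult_of_rmul m a : mult_of (rmul m a) = mult_of a ** m.
Proof. by apply: multiplier_ext => x /=; rewrite ?rmulM ?lrmul. Qed.

Lemma mone_mull m : mone ** m = m.
Proof. exact: multiplier_ext. Qed.
Lemma mone_mulr m : m ** mone = m.
Proof. exact: multiplier_ext. Qed.

Lemma alg_ofK : Defs.nondegenerate A -> cancel (@mult_of K A) (@alg_of K A).
Proof.
move=> /mult_of_inj inj a; apply: inj; rewrite /alg_of.
by case: xgetP => // /(_ a) [].
Qed.

End One.

Lemma mtensM (A B : nualgType K) (m m' : multiplier A) (n n' : multiplier B) :
  mtens m n ** mtens m' n' = mtens (m ** m') (n ** n').
Proof.
by apply: multiplier_ext => x /=; rewrite tmap_comp.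
Qed.

Lemma tens_multiplier_ext (A B : nualgType K) (m n : multiplier (tens A B)) :
  (forall a b, lmul m (a \ox b) = lmul n (a \ox b)) ->
  (forall a b, rmul m (a \ox b) = rmul n (a \ox b)) -> m = n.
Proof.
by move=> lE rE; apply: multiplier_ext; apply: tens_linear_ext => //;
  apply: linearP.
Qed.

Lemma lmul_mtens (A B : nualgType K) (m : multiplier A) (n : multiplier B) a b :
  lmul (mtens m n) (a \ox b) = lmul m a \ox lmul n b.
Proof. exact: tmap_tensor. Qed.
Lemma rmul_mtens (A B : nualgType K) (m : multiplier A) (n : multiplier B) a b :
  rmul (mtens m n) (a \ox b) = rmul m a \ox rmul n b.
Proof. exact: tmap_tensor. Qed.

Lemma mtens_mult_of (A B : nualgType K) (a : A) (b : B) :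
  mtens (mult_of a) (mult_of b) = mult_of (a \ox b).
Proof.
by apply: tens_multiplier_ext => c d;
  rewrite ?lmul_mtens ?rmul_mtens /= tensM.
Qed.

Lemma mult_of_tens (A B : nualgType K) (a : A) (b : B) :
  mult_of (a \ox b) = mtens (mult_of a) mone ** mtens mone (mult_of b).
Proof. by rewrite mtensM mone_mull mone_mulr mtens_mult_of. Qed.

Lemma mult_of_tens_r (A B : nualgType K) (a : A) (b : B) :
  mult_of (a \ox b) = mtens mone (mult_of b) ** mtens (mult_of a) mone.
Proof. by rewrite mtensM mone_mull mone_mulr mtens_mult_of. Qed.

End MultiplierElements.

Lemma mtens_star (K : numClosedFieldType) (A B : starAlgType K)
    (m : multiplier A) (n : multiplier B) :
  star (mtens m n) = mtens (star m) (star n).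
Proof.
apply: tens_multiplier_ext => a b; rewrite ?lmul_mtens ?rmul_mtens;
rewrite -[LHS]/(star (_ (star (a \ox b)))) [star (a \ox b)]tens_star_tensor.
  by rewrite rmul_mtens [star _]tens_star_tensor.
by rewrite lmul_mtens [star _]tens_star_tensor.
Qed.

Lemma star_mult_of (K : numClosedFieldType) (A : starAlgType K) (a : A) :
  star (mult_of a) = mult_of (star a).
Proof.
by apply: multiplier_ext => x; rewrite /star /= -/(star _) starM starK.
Qed.

(** * Tensoring a coproduct with the identity map *)

Section ComulLinear.
Variables (K : fieldType) (D : nualgType K).

Lemma mtens_linearl (A B : nualgType K) (n : multiplier B) :
  linear (fun m : multiplier A => mtens m n).
Proof.
move=> k m m'; apply: tens_multiplier_ext => a b; rewrite ?lmul_mtens ?rmul_mtens.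
  rewrite -[RHS]/(k *: lmul (mtens m n) (a \ox b) + lmul (mtens m' n) (a \ox b)).
  by rewrite !lmul_mtens -[lmul _ a]/(k *: lmul m a + lmul m' a) tensorDl tensorZl.
rewrite -[RHS]/(k *: rmul (mtens m n) (a \ox b) + rmul (mtens m' n) (a \ox b)).
by rewrite !rmul_mtens -[rmul _ a]/(k *: rmul m a + rmul m' a) tensorDl tensorZl.
Qed.

Lemma mtens_linearr (A B : nualgType K) (m : multiplier A) :
  linear (fun n : multiplier B => mtens m n).
Proof.
move=> k n n'; apply: tens_multiplier_ext => a b; rewrite ?lmul_mtens ?rmul_mtens.
  rewrite -[RHS]/(k *: lmul (mtens m n) (a \ox b) + lmul (mtens m n') (a \ox b)).
  by rewrite !lmul_mtens -[lmul _ b]/(k *: lmul n b + lmul n' b) tensorDr tensorZr.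
rewrite -[RHS]/(k *: rmul (mtens m n) (a \ox b) + rmul (mtens m n') (a \ox b)).
by rewrite !rmul_mtens -[rmul _ b]/(k *: rmul n b + rmul n' b) tensorDr tensorZr.
Qed.

Variable Delta : {linear D -> multiplier (tens D D)}.

Lemma comul_l_bilin : bilin (fun (a b : D) => mtens (Delta a) (mult_of b)).
Proof.
by split=> [b|a] k x y; rewrite linearP (mtens_linearl, mtens_linearr).
Qed.
Lemma comul_r_bilin : bilin (fun (a b : D) => mtens (mult_of a) (Delta b)).
Proof.
by split=> [b|a] k x y; rewrite linearP (mtens_linearl, mtens_linearr).
Qed.
HB.instance Definition _ :=
  GRing.isLinear.Build K (tens D D) (multiplier (tens (tens D D) D)) *:%R
    (comul_l Delta) (tsum_linear comul_l_bilin).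
HB.instance Definition _ :=
  GRing.isLinear.Build K (tens D D) (multiplier (tens D (tens D D))) *:%R
    (comul_r Delta) (tsum_linear comul_r_bilin).
Lemma comul_lE (a b : D) : comul_l Delta (a \ox b) = mtens (Delta a) (mult_of b).
Proof. by apply: tsum_tens; have [] := bilinP comul_l_bilin. Qed.
Lemma comul_rE (a b : D) : comul_r Delta (a \ox b) = mtens (mult_of a) (Delta b).
Proof. by apply: tsum_tens; have [] := bilinP comul_r_bilin. Qed.

End ComulLinear.

Lemma numul_inj_l (K : fieldType) (A : nualgType K) (x y : A) :
  Defs.nondegenerate A -> (forall z, x ** z = y ** z) -> x = y.
Proof.
move=> [nl _] xy; apply/eqP; rewrite -subr_eq0; apply/eqP; apply: nl => z.
by rewrite numulDl xy -numulDl subrr numul0l.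
Qed.

Lemma numul_inj_r (K : fieldType) (A : nualgType K) (x y : A) :
  Defs.nondegenerate A -> (forall z, z ** x = z ** y) -> x = y.
Proof.
move=> [_ nr] xy; apply/eqP; rewrite -subr_eq0; apply/eqP; apply: nr => z.
by rewrite linearB /= xy subrr.
Qed.

(** * Slices of tensors multiplied in one leg *)

Section LegMultipliers.
Variables (K : fieldType) (A B : nualgType K).
Local Notation rleg b := (@mtens K A B mone (mult_of b)).
Local Notation lleg a := (@mtens K A B (mult_of a) mone).

Lemma slice_r_lleg_l (w : {scalar B}) c x :
  slice_r w (lmul (lleg c) x) = c ** slice_r w x.
Proof. exact: slice_r_tmap. Qed.
Lemma slice_r_lleg_r (w : {scalar B}) c x :
  slice_r w (rmul (lleg c) x) = slice_r w x ** c.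
Proof. exact: (slice_r_tmap w (numulr c)). Qed.
Lemma slice_r_rleg_l (w : {scalar B}) b x :
  slice_r w (lmul (rleg b) x) = slice_r (w \o numul b) x.
Proof. exact: (slice_r_tmap w idfun (numul b)). Qed.
Lemma slice_r_rleg_r (w : {scalar B}) b x :
  slice_r w (rmul (rleg b) x) = slice_r (w \o numulr b) x.
Proof. exact: (slice_r_tmap w idfun (numulr b)). Qed.
Lemma slice_l_rleg_l (w : {scalar A}) b x :
  slice_l w (lmul (rleg b) x) = b ** slice_l w x.
Proof. exact: (slice_l_tmap w idfun (numul b)). Qed.
Lemma slice_l_rleg_r (w : {scalar A}) b x :
  slice_l w (rmul (rleg b) x) = slice_l w x ** b.
Proof. exact: (slice_l_tmap w idfun (numulr b)). Qed.

End LegMultipliers.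

(** * The hypergroup axioms for a unital algebra with a coproduct into its tensor square *)

Section UnitalComultiplication.
Variables (K : fieldType) (D : nualgType K) (one : D).
Hypothesis one_id : is_identity one.
Local Notation DD := (tens D D).
Variable d : {linear D -> DD}.

Definition elt_comul (a : D) : multiplier DD := mult_of (d a).
Lemma elt_comul_linear : linear elt_comul.
Proof. by move=> k x y; rewrite /elt_comul !linearP. Qed.
HB.instance Definition _ :=
  GRing.isLinear.Build K D (multiplier DD) *:%R elt_comul elt_comul_linear.

Lemma one_numul (x : D) : one ** x = x.
Proof. by have [] := one_id x. Qed.
Lemma numul_one (x : D) : x ** one = x.
Proof. by have [] := one_id x. Qed.

Lemma unital_nondegenerate : Defs.nondegenerate D.
Proof.
by split=> x x0; [rewrite -[x]numul_one x0|rewrite -[x]one_numul x0].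
Qed.
Let ndDD : Defs.nondegenerate DD :=
  tens_nondegenerate unital_nondegenerate unital_nondegenerate.

Lemma mone_unital : @mone K D = mult_of one.
Proof.
by apply: multiplier_ext => x; rewrite /= ?one_numul ?numul_one.
Qed.
Lemma rleg_unital (b : D) :
  mtens mone (mult_of b) = mult_of (one \ox b) :> multiplier DD.
Proof. by rewrite mone_unital mtens_mult_of. Qed.
Lemma lleg_unital (b : D) :
  mtens (mult_of b) mone = mult_of (b \ox one) :> multiplier DD.
Proof. by rewrite mone_unital mtens_mult_of. Qed.

Lemma in_alg_elt_comul (a b : D) :
  [/\ Defs.in_alg (elt_comul a ** mtens mone (mult_of b)),
      Defs.in_alg (mtens (mult_of a) mone ** elt_comul b),
      Defs.in_alg (elt_comul a ** mtens (mult_of b) mone) &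
      Defs.in_alg (mtens mone (mult_of a) ** elt_comul b)].
Proof.
by split; rewrite ?rleg_unital ?lleg_unital -mult_ofM; eexists; reflexivity.
Qed.

Lemma comul_l_elt x : comul_l elt_comul x = mult_of (tmap d idfun x).
Proof.
elim/tens_ind: x => [|a b x IH]; first by rewrite !linear0.
by rewrite !linearD /= IH comul_lE tmap_tensor -mtens_mult_of.
Qed.
Lemma comul_r_elt x : comul_r elt_comul x = mult_of (tmap idfun d x).
Proof.
elim/tens_ind: x => [|a b x IH]; first by rewrite !linear0.
by rewrite !linearD /= IH comul_rE tmap_tensor -mtens_mult_of.
Qed.

Lemma one_tens_numul (x : DD) : (one \ox one) ** x = x.
Proof.
elim/tens_ind: x => [|a b x IH]; first by rewrite !linear0.
by rewrite !linearD /= IH tensM !one_numul.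
Qed.
Lemma tens_numul_one (x : DD) : x ** (one \ox one) = x.
Proof.
elim/tens_ind: x => [|a b x IH]; first by rewrite numul0l.
by rewrite numulDl IH tensM !numul_one.
Qed.

Lemma assoc_eq_mult_of (x : tens DD D) y :
  tassoc x = y -> assoc_eq (mult_of x) (mult_of y).
Proof. by move=> <- z; rewrite /= !tassocM. Qed.

(** The covering factors b and c sit in legs that [d] does not touch, so they come out of
    [tmap d idfun] and [tmap idfun d] without multiplicativity of [d]. *)
Lemma coassociative_elt_comul :
  (forall a, tassoc (tmap d idfun (d a)) = tmap idfun d (d a)) ->
  coassociative elt_comul.
Proof.
move=> d_coassoc a b c; rewrite rleg_unital lleg_unital -!mult_ofM !alg_ofK //.
rewrite comul_l_elt comul_r_elt mone_unital.
rewrite !mtens_mult_of -!mult_ofM; apply: assoc_eq_mult_of.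
rewrite tassocM tassocE.
have -> x : tmap d idfun (x ** (one \ox b)) =
    tmap d idfun x ** ((one \ox one) \ox b).
  elim/tens_ind: x => [|p q x IH]; first by rewrite !(linear0, numul0l).
  rewrite numulDl !linearD /= numulDl IH; congr (_ + _).
  by rewrite tensM !tmap_tensor tensM /= numul_one tens_numul_one.
have -> x : tmap idfun d ((c \ox one) ** x) =
    (c \ox (one \ox one)) ** tmap idfun d x.
  elim/tens_ind: x => [|p q x IH]; first by rewrite !linear0.
  rewrite !linearD /= IH; congr (_ + _).
  by rewrite tensM !tmap_tensor tensM /= one_numul one_tens_numul.
by rewrite tassocM tassocE d_coassoc numulA.
Qed.

Lemma slice_l_one_mulr (w : {scalar D}) (x : DD) b :
  slice_l w (x ** (one \ox b)) = slice_l w x ** b.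
Proof. by rewrite -slice_l_rleg_r rleg_unital. Qed.
Lemma slice_l_one_mull (w : {scalar D}) (x : DD) b :
  slice_l w ((one \ox b) ** x) = b ** slice_l w x.
Proof. by rewrite -slice_l_rleg_l rleg_unital. Qed.
Lemma slice_r_one_mulr (w : {scalar D}) (x : DD) b :
  slice_r w (x ** (b \ox one)) = slice_r w x ** b.
Proof. by rewrite -slice_r_lleg_r lleg_unital. Qed.
Lemma slice_r_one_mull (w : {scalar D}) (x : DD) b :
  slice_r w ((b \ox one) ** x) = b ** slice_r w x.
Proof. by rewrite -slice_r_lleg_l lleg_unital. Qed.

Lemma is_counit_elt_comul (eps : {scalar D}) :
  (forall a b, eps (a ** b) = eps a * eps b) ->
  (forall a, slice_l eps (d a) = a) -> (forall a, slice_r eps (d a) = a) ->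
  is_counit elt_comul eps.
Proof.
move=> epsM epsl epsr; split=> // a.
split=> b; rewrite ?rleg_unital ?lleg_unital -!mult_ofM !alg_ofK //.
  by rewrite slice_l_one_mulr slice_l_one_mull epsl.
by rewrite slice_r_one_mulr slice_r_one_mull epsr.
Qed.

Lemma left_invariant_elt_comul (psi : {scalar D}) :
  (forall a, slice_r psi (d a) = psi a *: one) -> left_invariant elt_comul psi.
Proof.
move=> psi_inv a b; rewrite lleg_unital -!mult_ofM !alg_ofK //.
rewrite slice_r_one_mulr slice_r_one_mull psi_inv numulZl numulZr.
by rewrite one_numul numul_one.
Qed.

Lemma is_antipode_elt_comul (psi : {scalar D}) (S : {linear D -> D}) :
  bijective S -> (forall a b, S (a ** b) = S b ** S a) ->
  (forall a b, S (slice_r psi (d a ** (one \ox b))) =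
               slice_r psi ((one \ox a) ** d b)) ->
  is_antipode elt_comul psi S.
Proof.
by move=> Sbij SM SP; split=> // a b; rewrite !rleg_unital -!mult_ofM !alg_ofK.
Qed.

End UnitalComultiplication.

(** * The canonical maps of a multiplier Hopf star-algebra *)

Section QuantumGroup.
Variables (K : numClosedFieldType) (A : starAlgType K).
Variable Delta : {linear A -> multiplier (tens A A)}.
Hypothesis ndA : Defs.nondegenerate A.
Hypothesis DeltaM : forall a b, Delta (a ** b) = Delta a ** Delta b.
Hypothesis Delta_star : forall a, Delta (star a) = star (Delta a).
Hypothesis Delta_coassoc : coassociative Delta.

Local Notation AA := (tens A A).
Local Notation rleg b := (@mtens K A A mone (mult_of b)).
Local Notation lleg a := (@mtens K A A (mult_of a) mone).

Variables T1 T1' T2 : {linear AA -> AA}.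
Hypothesis T1E : forall a b, mult_of (T1 (a \ox b)) = Delta a ** rleg b.
Hypothesis T2E : forall a b, mult_of (T2 (a \ox b)) = lleg a ** Delta b.
Hypothesis T1K : cancel T1 T1'.
Hypothesis T1'K : cancel T1' T1.

Let ndAA : Defs.nondegenerate AA := tens_nondegenerate ndA ndA.
Let mult_inj : injective (@mult_of K AA) := mult_of_inj ndAA.

Lemma T1_lmul a b x : T1 (a \ox b) ** x = lmul (Delta a) (lmul (rleg b) x).
Proof. by have := congr1 (fun m => lmul m x) (T1E a b). Qed.
Lemma T2_lmul a b x : T2 (a \ox b) ** x = lmul (lleg a) (lmul (Delta b) x).
Proof. by have := congr1 (fun m => lmul m x) (T2E a b). Qed.

Lemma tmap_T2_lmul c x (y : AA) r :
  tmap (T2 \o tensor c) idfun x ** (y \ox r) =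
  lmul (mtens (lleg c) mone ** comul_l Delta x) (y \ox r).
Proof.
elim/tens_ind: x => [|u v x IH]; first by rewrite !linear0 numul0l.
rewrite !linearD /= numulDl IH.
rewrite -[RHS]/(lmul (mtens (lleg c) mone ** comul_l Delta (u \ox v)) (y \ox r) +
  lmul (mtens (lleg c) mone ** comul_l Delta x) (y \ox r)).
congr (_ + _); rewrite tmap_tensor tensM comul_lE mtensM lmul_mtens /=.
by rewrite T2_lmul.
Qed.

Lemma tmap_T1_lmul b x p (y : AA) :
  tmap idfun (T1 \o tensorl b) x ** (p \ox y) =
  lmul (comul_r Delta x ** mtens mone (rleg b)) (p \ox y).
Proof.
elim/tens_ind: x => [|u v x IH]; first by rewrite !linear0 !numul0l.
rewrite linearD /= numulDl IH linearD /=.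
rewrite -[RHS]/(lmul (comul_r Delta (u \ox v) ** mtens mone (rleg b)) (p \ox y) +
  lmul (comul_r Delta x ** mtens mone (rleg b)) (p \ox y)).
congr (_ + _); rewrite tmap_tensor tensM comul_rE mtensM lmul_mtens /=.
by rewrite T1_lmul.
Qed.

(** Coassociativity as an identity of elements of A # (A # A): both sides act alike by left
    multiplication on elementary tensors, and the triple tensor product is non-degenerate. *)
Lemma coassoc_elements c a b :
  tassoc (tmap (T2 \o tensor c) idfun (T1 (a \ox b))) =
  tmap idfun (T1 \o tensorl b) (T2 (c \ox a)).
Proof.
apply: (numul_inj_l (tens_nondegenerate ndA ndAA)).
apply: tens_linear_ext; [exact: linearP..|move=> p y].
elim/tens_ind: y => [|q r y IH]; first by rewrite !linear0.
rewrite !linearD /= IH; congr (_ + _) => {y IH}.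
rewrite -tassocE -tassocM tmap_T2_lmul tassocE tmap_T1_lmul.
have [+ _] := Delta_coassoc a b c ((p \ox q) \ox r).
by rewrite -T1E -T2E !alg_ofK // tassocE.
Qed.

Lemma T1_surj y : exists x, y = T1 x.
Proof. by exists (T1' y); rewrite T1'K. Qed.

Lemma T1M a b c : T1 ((a ** b) \ox c) = lmul (Delta a) (T1 (b \ox c)).
Proof. by apply: mult_inj; rewrite mult_of_lmul !T1E DeltaM numulA. Qed.

(* T3 a b = Delta(a)(b # 1) and T4 a b = (1 # a)Delta(b); see T3E and T4E. *)
Definition T3 a b : AA := star (T2 (star b \ox star a)).
Definition T4 a b : AA := star (T1 (star b \ox star a)).

Lemma mone_star (B : starAlgType K) : star (@mone K B) = mone.
Proof. by apply: multiplier_ext => x; rewrite /star /= -/(star _) starK. Qed.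

Lemma T3E a b : mult_of (T3 a b) = Delta a ** lleg b.
Proof.
rewrite /T3 -star_mult_of T2E starM mtens_star mone_star star_mult_of.
by rewrite -Delta_star !starK.
Qed.
Lemma T4E a b : mult_of (T4 a b) = rleg a ** Delta b.
Proof.
rewrite /T4 -star_mult_of T1E starM mtens_star mone_star star_mult_of.
by rewrite -Delta_star !starK.
Qed.
Lemma T3M a b c : T3 (a ** b) c = lmul (Delta a) (T3 b c).
Proof. by apply: mult_inj; rewrite mult_of_lmul !T3E DeltaM numulA. Qed.

Lemma legC a b : lleg a ** rleg b = rleg b ** lleg a.
Proof. by rewrite !mtensM !mone_mull !mone_mulr. Qed.

(** Covering the first leg by c brings an expression in Delta into the range where [T2] applies;
    non-degeneracy removes the cover again. *)
Lemma lleg_inj (x y : AA) :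
  (forall c, lmul (lleg c) x = lmul (lleg c) y) -> x = y.
Proof.
move=> xy; apply: (numul_inj_r ndAA); apply: tens_linear_ext.
- exact: numul_linearl.
- exact: numul_linearl.
move=> a b; have E z : (a \ox b) ** z = lmul (rleg b) (lmul (lleg a) z).
  by have := congr1 (fun m => lmul m z) (mult_of_tens_r a b).
by rewrite !E xy.
Qed.

(** * Left invariance and the inverse of [T1] *)

Variable phi : {scalar A}.
Hypothesis phi_inv : left_invariant Delta phi.
Hypothesis phi_pos : forall a, 0 <= phi (star a ** a).
Variable e : A.
Hypothesis phi_e : phi e = 1.

Lemma phi_T3 a b : slice_r phi (T3 a b) = phi a *: b.
Proof. by have [+ _] := phi_inv a b; rewrite -T3E alg_ofK. Qed.

Definition F (y : AA) : A := slice_r phi (T1 y).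
Lemma F_linear : linear F.
Proof. by move=> k x y; rewrite /F !linearP. Qed.
HB.instance Definition _ := GRing.isLinear.Build K AA A *:%R F F_linear.

(* W a (Delta(b)(d # 1)) = a_1 # b_1 d phi(a_2 b_2); see T1_W. *)
Definition W (a : A) (z : AA) : AA := tmap (F \o tensor a) idfun (tswap z).
Lemma W_linear a : linear (W a).
Proof. by move=> k x y; rewrite /W !linearP. Qed.
HB.instance Definition _ a := GRing.isLinear.Build K AA AA *:%R (W a) (W_linear a).
Lemma W_tensor a p q : W a (p \ox q) = F (a \ox q) \ox p.
Proof. by rewrite /W tswapE tmap_tensor. Qed.

Lemma T1_lleg s q p : rmul (lleg p) (T1 (s \ox q)) = lmul (Delta s) (p \ox q).
Proof.
apply: mult_inj; rewrite mult_of_rmul T1E mult_of_lmul mult_of_tens_r.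
by rewrite numulA.
Qed.

Lemma T1_T2 a b c : lmul (lleg c) (T1 (a \ox b)) = rmul (rleg b) (T2 (c \ox a)).
Proof. by apply: mult_inj; rewrite mult_of_lmul mult_of_rmul T1E T2E numulA. Qed.

Lemma F_lleg s q p : F (s \ox q) ** p = slice_r phi (lmul (Delta s) (p \ox q)).
Proof. by rewrite /F -slice_r_lleg_r T1_lleg. Qed.

Lemma prod_W s z : tens_prod (W s z) = slice_r phi (lmul (Delta s) z).
Proof.
elim/tens_ind: z => [|p q z IH]; first by rewrite !linear0.
by rewrite !linearD /= IH W_tensor tens_prodE F_lleg.
Qed.

(** Coassociativity sliced by [phi] in the third leg: both sides are c a_1 # a_2 phi(a_3 q). *)
Lemma T2_F c a q :
  T2 (c \ox F (a \ox q)) = tmap idfun (F \o tensorl q) (T2 (c \ox a)).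
Proof.
have := congr1 (tmap idfun (slice_r phi)) (coassoc_elements c a q).
by rewrite tmap_slice_assoc slice_r_tmap tmap_comp.
Qed.

(** Writing (c # 1)Delta(a) as a finite sum turns its legs into genuine elements. For z = p # q,
    [T2_F] gives c a_1 # F(a_2 # q) p, and the second factor is a slice of Delta(a_2) z. *)
Lemma lleg_T1_W c a z s :
  T2 (c \ox a) = \sum_(p <- s) p.1 \ox p.2 ->
  lmul (lleg c) (T1 (W a z)) =
  \sum_(p <- s) p.1 \ox slice_r phi (lmul (Delta p.2) z).
Proof.
move=> sE; elim/tens_ind: z => [|p q z IH].
  by rewrite !linear0 big1 // => p _; rewrite !linear0.
rewrite !linearD /= in IH *; rewrite IH.
under [RHS]eq_bigr => i _ do rewrite !linearD /=.
rewrite big_split /=; congr (_ + _).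
rewrite -[LHS]/(lmul (lleg c) _) W_tensor T1_T2 T2_F sE.
rewrite (linear_sum (tmap idfun (F \o tensorl q))).
rewrite (linear_sum (rmul (rleg p))); apply: eq_bigr => i _.
by rewrite /= tmap_tensor -[LHS]/(rmul (rleg p) _) rmul_mtens /= F_lleg.
Qed.

(** For z = Delta(b)(d # 1), the product Delta(a_2) z is Delta(a_2 b)(d # 1), whose slice is phi(a_2
    b) d by left invariance. *)
Lemma T1_W a b d : T1 (W a (T3 b d)) = F (a \ox b) \ox d.
Proof.
apply: lleg_inj => c; have sE := tens_reprK (T2 (c \ox a)).
rewrite tens_ofE in sE; rewrite (lleg_T1_W _ (esym sE)) lmul_mtens /=.
rewrite -slice_r_lleg_l T1_T2 slice_r_rleg_r -[in RHS]sE.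
rewrite (linear_sum (slice_r (phi \o numulr b))).
rewrite -[RHS]/(tensorl d _) [RHS]linear_sum; apply: eq_bigr => i _ /=.
by rewrite -T3M phi_T3 slice_rE /tensorl tensorZl linearZ.
Qed.

(** * The counit *)

Lemma F_surj z : exists y, z = F y.
Proof. by exists (T1' (z \ox e)); rewrite /F T1'K slice_rE phi_e scale1r. Qed.

Lemma T1'_F a b d : T1' (F (a \ox b) \ox d) = W a (T3 b d).
Proof. by rewrite -T1_W T1K. Qed.

(** For y = a # b the left side is a_1 b_1 d phi(a_2 b_2), a slice of Delta(a b)(d # 1); left
    invariance evaluates it. *)
Lemma prod_T1'_F y d : tens_prod (T1' (F y \ox d)) = phi (tens_prod y) *: d.
Proof.
elim/tens_ind: y => [|a b y IH]; first
  by rewrite !linear0 tensor0l !linear0 scale0r.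
rewrite !linearD /= tensorDl !linearD /= IH scalerDl; congr (_ + _).
by rewrite T1'_F prod_W -T3M phi_T3 tens_prodE.
Qed.

(** The scalar eps(z) with m(T1^-1(z # d)) = eps(z) d, read off at d = e by [phi e = 1]. *)
Definition counit (z : A) : K := phi (tens_prod (T1' (z \ox e))).
Lemma counit_scalar : scalar counit.
Proof. by move=> k x y; rewrite /counit tensorDl tensorZl !linearP. Qed.
HB.instance Definition _ := GRing.isLinear.Build K A K *%R counit counit_scalar.

Lemma prod_T1' z d : tens_prod (T1' (z \ox d)) = counit z *: d.
Proof.
have [y ->] := F_surj z.
by rewrite prod_T1'_F /counit prod_T1'_F linearZ /= phi_e mulr1.
Qed.

Lemma counit_F a b : counit (F (a \ox b)) = phi (a ** b).
Proof. by rewrite /counit prod_T1'_F linearZ /= phi_e mulr1 tens_prodE. Qed.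

Lemma slice_counit_T1 y : slice_l counit (T1 y) = tens_prod y.
Proof.
rewrite -[in RHS](T1K y); elim/tens_ind: (T1 y) => [|a b x IH].
  by rewrite !linear0.
by rewrite !linearD /= IH slice_lE prod_T1'.
Qed.

Lemma slice_counit_lmul a y :
  slice_l counit (lmul (Delta a) y) = a ** slice_l counit y.
Proof.
have [x ->] := T1_surj y.
elim/tens_ind: x => [|b c x IH]; first by rewrite !linear0.
rewrite !linearD /= IH -T1M !slice_counit_T1 !tens_prodE.
by rewrite numulA.
Qed.

(** By surjectivity of [T1] every tensor is a sum of terms Delta(c)(1 # d), and eps # iota sends
    Delta(c)(p # d) to eps(p) c d. Hence a right factor p in the first leg comes out as eps(p). *)
Lemma counitM a b : counit (a ** b) = counit a * counit b.
Proof.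
have key w p : slice_l counit (rmul (lleg p) w) = counit p *: slice_l counit w.
  have [x ->] := T1_surj w.
  elim/tens_ind: x => [|c d x IH]; first by rewrite !linear0.
  rewrite !linearD /= in IH *; rewrite IH; congr (_ + _).
  rewrite -[tmap _ _ _]/(rmul (lleg p) _) T1_lleg slice_counit_lmul slice_lE.
  by rewrite slice_counit_T1 tens_prodE linearZ.
have := congr1 phi (key (a \ox e) b).
by rewrite rmul_mtens !slice_lE !linearZ /= phi_e !mulr1 mulrC.
Qed.

(** The right counit law follows from the left one: slicing the middle leg of [coassoc_elements] by
    eps proves it on the first legs of all T1(a # b), and these tensors span A # A. *)
Lemma slice_counit_T2 c a : slice_r counit (T2 (c \ox a)) = c ** a.
Proof.
have swap (x : tens AA A) :
    tmap idfun (slice_l counit) (tassoc x) = tmap (slice_r counit) idfun x.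
  elim/tens_ind: x => [|y b x IH]; first by rewrite !linear0.
  rewrite !linearD /= IH; congr (_ + _); rewrite tmap_tensor /=.
  elim/tens_ind: y => [|p q y IHy]; first by rewrite !(tensor0l, linear0).
  rewrite tensorDl !linearD /= tensorDl IHy.
  by rewrite tassocE tmap_tensor /= slice_lE slice_rE tensorZl -tensorZr.
have key a' b : tmap (slice_r counit \o (T2 \o tensor c)) idfun (T1 (a' \ox b)) =
    tmap (numul c) idfun (T1 (a' \ox b)).
  have := congr1 (tmap idfun (slice_l counit)) (coassoc_elements c a' b).
  rewrite swap !tmap_comp => ->; rewrite -[RHS]/(lmul (lleg c) _) T1_T2.
  elim/tens_ind: (T2 _) => [|p q y IH]; first by rewrite !linear0.
  rewrite !linearD /= in IH *; rewrite IH tmap_tensor /=; congr (_ + _).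
  rewrite /tensorl slice_counit_T1 tens_prodE.
  by rewrite -[RHS]/(rmul (rleg b) _) rmul_mtens.
have key' (y : AA) : tmap (slice_r counit \o (T2 \o tensor c)) idfun y =
    tmap (numul c) idfun y.
  have [x ->] := T1_surj y.
  elim/tens_ind: x => [|a' b x IH]; first by rewrite !linear0.
  by rewrite !linearD /= in IH *; rewrite IH key.
have := congr1 (slice_r phi) (key' (a \ox e)).
by rewrite !tmap_tensor !slice_rE phi_e !scale1r.
Qed.

Lemma slice_counit_T3 a b : slice_r counit (T3 a b) = a ** b.
Proof.
apply: (numul_inj_r ndA) => c; rewrite -slice_r_lleg_l.
have -> : lmul (lleg c) (T3 a b) = rmul (lleg b) (T2 (c \ox a)).
  by apply: mult_inj; rewrite mult_of_lmul mult_of_rmul T2E T3E numulA.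
by rewrite slice_r_lleg_r slice_counit_T2 numulA.
Qed.

(** If eps were zero, the product map m would vanish, since m(T1^-1(p # q)) = eps(p) q and [T1] is
    bijective; then e = 0, against [phi e = 1]. *)
Lemma counit_unit : exists z, counit z = 1.
Proof.
have [z z0] : exists z, counit z != 0.
  apply: contrapT => counit0.
  have e0 : e = 0.
    apply: ndA.1 => b; rewrite -tens_prodE -(T1K (_ \ox _)).
    elim/tens_ind: (T1 _) => [|p q x IH]; first by rewrite !linear0.
    rewrite !linearD /= IH addr0 prod_T1'.
    have [->|p0] := eqVneq (counit p) 0; first by rewrite scale0r.
    by case: counit0; exists p.
  by move: phi_e; rewrite e0 linear0 => /esym/eqP; rewrite oner_eq0.
by exists ((counit z)^-1 *: z); rewrite linearZ /= mulVf.
Qed.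

(** * Hermitian symmetry of the integral *)

Lemma prod_surj (x : A) : exists y : AA, x = tens_prod y.
Proof.
by have [z z1] := counit_unit; exists (T1' (z \ox x)); rewrite prod_T1' z1 scale1r.
Qed.

(** Polarisation: positivity makes [phi (star x ** x)] real, and the cases x = a + b and x = a + i b
    together give the claim. *)
Lemma phi_hermitian_prod a b : phi (star a ** b) = (phi (star b ** a))^*.
Proof.
have real x : (phi (star x ** x))^* = phi (star x ** x).
  by apply/CrealP; rewrite ger0_real.
have := real (a + b); have := real (a + 'i *: b).
rewrite !(starD, starZ, numulDl, numulDr, numulZl, numulZr) conjCi !linearD /=.
rewrite !linearZ /= !rmorphD !rmorphM /= !rmorphN /= conjCi !real.
set u := phi (star a ** b); set v := phi (star b ** a).
set p := phi (star a ** a); set q := phi (star b ** b) => h1 h2.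
have h3 : 'i * (v^* - u^* - u + v) = 0.
  move/eqP: h1; rewrite -subr_eq0 => /eqP h1; rewrite -[RHS]h1; ring.
have h4 : u^* + v^* - u - v = 0.
  move/eqP: h2; rewrite -subr_eq0 => /eqP h2; rewrite -[RHS]h2; ring.
move/eqP: h3; rewrite mulf_eq0 (negPf (neq0Ci _)) /= => /eqP h3.
have : 2 * (u - v^*) = 0.
  transitivity (- ((v^* - u^* - u + v) + (u^* + v^* - u - v))); first by ring.
  by rewrite h3 h4 addr0 oppr0.
by move/eqP; rewrite mulf_eq0 pnatr_eq0 subr_eq0 => /eqP.
Qed.

Lemma phi_hermitian (a : A) : phi (star a) = (phi a)^*.
Proof.
have [y ->] := prod_surj a.
elim/tens_ind: y => [|b c y IH]; first by rewrite !linear0 star0 linear0 rmorph0.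
rewrite linearD starD linearD /= IH [in RHS]linearD [in RHS]rmorphD; congr (_ + _).
by rewrite tens_prodE starM phi_hermitian_prod starK.
Qed.

Lemma star_slice_r (x : AA) : star (slice_r phi x) = slice_r phi (star x).
Proof.
elim/tens_ind: x => [|a b x IH]; first by rewrite !(linear0, star0).
rewrite !(linearD, starD) /= IH; congr (_ + _).
by rewrite [star (a \ox b)]tens_star_tensor !slice_rE starZ phi_hermitian.
Qed.

(** * The antipode *)

Definition G (y : AA) : A := star (F (star (tswap y))).
Lemma G_linear : linear G.
Proof. by move=> k x y; rewrite /G linearP starZD linearP starZD /= conjCK. Qed.
HB.instance Definition _ := GRing.isLinear.Build K AA A *:%R G G_linear.

(** Since [phi] is hermitian, the star passes through the slice; so [G], built from [F] by star and
    flip, is the other side of the antipode formula. *)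
Lemma G_tensor a b : G (a \ox b) = slice_r phi (T4 a b).
Proof.
by rewrite /G tswapE [star (b \ox a)]tens_star_tensor /F star_slice_r.
Qed.

Lemma G_T3 a b d : slice_r phi (lmul (rleg a) (T3 b d)) = G (a \ox b) ** d.
Proof.
rewrite G_tensor -slice_r_lleg_r; congr slice_r.
by apply: mult_inj; rewrite mult_of_lmul mult_of_rmul T3E T4E numulA.
Qed.

Lemma star_G y : star (G y) = F (star (tswap y)).
Proof. exact: starK. Qed.

Lemma G_star_swap (y : AA) : G (star (tswap y)) = star (F y).
Proof.
rewrite /G; congr (star (F _)).
elim/tens_ind: y => [|a b y IH]; first by rewrite !(linear0, star0).
rewrite !(linearD, starD) /= IH; congr (_ + _).
rewrite tswapE [star (b \ox a)]tens_star_tensor tswapE.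
by rewrite [star _]tens_star_tensor !starK.
Qed.

(** The map z |-> T1^-1(z # e) is a right inverse of [F]; [antipode_F] shows that any other preimage
    under [F] gives the same value. *)
Definition antipode (z : A) : A := G (T1' (z \ox e)).
Lemma antipode_linear : linear antipode.
Proof. by move=> k x y; rewrite /antipode tensorDl tensorZl !linearP. Qed.
HB.instance Definition _ :=
  GRing.isLinear.Build K A A *:%R antipode antipode_linear.

Lemma slice_counit_W a (z : AA) :
  slice_l counit (W a z) = slice_r phi (lmul (rleg a) z).
Proof.
elim/tens_ind: z => [|p q z IH]; first by rewrite !linear0.
rewrite !linearD /= in IH *; rewrite IH W_tensor slice_lE /= counit_F.
congr (_ + _).
by rewrite -[tmap _ _ _]/(lmul (rleg a) _) lmul_mtens slice_rE.
Qed.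

Lemma slice_counit_T1'_F y d : slice_l counit (T1' (F y \ox d)) = G y ** d.
Proof.
elim/tens_ind: y => [|a b y IH]; first
  by rewrite !linear0 tensor0l !linear0 numul0l.
rewrite !linearD /= tensorDl !linearD /= IH numulDl; congr (_ + _).
by rewrite T1'_F slice_counit_W G_T3.
Qed.

Lemma antipode_numul z d : antipode z ** d = slice_l counit (T1' (z \ox d)).
Proof.
have [y zy] := F_surj z.
by rewrite /antipode -slice_counit_T1'_F /F T1'K slice_rE phi_e scale1r.
Qed.

Lemma antipode_F y : antipode (F y) = G y.
Proof.
by apply: (numul_inj_l ndA) => d; rewrite antipode_numul slice_counit_T1'_F.
Qed.

(** T1^-1 turns left multiplication by Delta(u) into left multiplication by u in the first leg,
    where eps is multiplicative. *)
Lemma slice_counit_T1'_lmul u x :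
  slice_l counit (T1' (lmul (Delta u) x)) = counit u *: slice_l counit (T1' x).
Proof.
have [w ->] := T1_surj x.
elim/tens_ind: w => [|p q w IH]; first by rewrite !linear0.
rewrite !linearD /= IH -T1M !T1K !slice_lE /= counitM.
by rewrite scalerA.
Qed.

(** With x # d = T1 w, the tensor x y # d is T1 w times y # 1. On Delta(u)(y # v) the map (eps #
    iota) T1^-1 gives eps(u) S(y) v, so S(y) comes out on the left. *)
Lemma antipodeM (x y : A) : antipode (x ** y) = antipode y ** antipode x.
Proof.
have key w : slice_l counit (T1' (rmul (lleg y) (T1 w))) =
    antipode y ** slice_l counit w.
  elim/tens_ind: w => [|u v w IH]; first by rewrite !linear0.
  rewrite !linearD /= in IH *; rewrite IH; congr (_ + _).
  rewrite -[tmap _ _ _]/(rmul (lleg y) _) T1_lleg slice_counit_T1'_lmul.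
  by rewrite -antipode_numul slice_lE linearZ.
apply: (numul_inj_l ndA) => d.
rewrite -numulA [antipode x ** d]antipode_numul -key T1'K.
by rewrite rmul_mtens antipode_numul.
Qed.

(** Star and flip exchange [F] and [G], while S takes F y to G y; doing this twice returns to F
    y. *)
Lemma star_antipodeK z : star (antipode (star (antipode z))) = z.
Proof.
have [y ->] := F_surj z.
by rewrite antipode_F star_G antipode_F G_star_swap starK.
Qed.

Lemma antipode_starK z : antipode (star (antipode (star z))) = z.
Proof.
by apply: (can_inj (@starK _ A)); rewrite -[in RHS](star_antipodeK (star z)).
Qed.

Lemma antipode_bij : bijective antipode.
Proof.
exists (fun z => star (antipode (star z))) => z; first exact: star_antipodeK.
exact: antipode_starK.
Qed.

(** * Faithfulness and definiteness of the integral *)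

Lemma slice_r_0 (w : {scalar A}) (x : AA) : w =1 (fun=> 0) -> slice_r w x = 0.
Proof.
move=> w0; elim/tens_ind: x => [|a b x IH]; first by rewrite !linear0.
by rewrite !linearD /= IH slice_rE w0 scale0r addr0.
Qed.

Lemma slice_counit_T1'_rleg x f :
  slice_l counit (T1' (rmul (rleg f) x)) = slice_l counit (T1' x) ** f.
Proof.
elim/tens_ind: x => [|p q x IH]; first by rewrite !linear0 numul0l.
rewrite !linearD /= in IH *; rewrite IH numulDl; congr (_ + _).
by rewrite -[tmap _ _ _]/(rmul (rleg f) _) rmul_mtens -!antipode_numul -numulA.
Qed.

(* S(a_1 d) a_2 = eps(a) S(d). *)
Lemma slice_counit_T1'_T3 a d :
  slice_l counit (T1' (T3 a d)) = counit a *: antipode d.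
Proof.
apply: (numul_inj_l ndA) => f; rewrite -slice_counit_T1'_rleg.
have -> : rmul (rleg f) (T3 a d) = lmul (Delta a) (d \ox f).
  apply: mult_inj; rewrite mult_of_rmul mult_of_lmul T3E mult_of_tens.
  by rewrite numulA.
by rewrite slice_counit_T1'_lmul -antipode_numul numulZl.
Qed.

(** Slicing Delta(a)(d # 1) by phi(c .) gives G(c # a) d = S(F(c # a)) d, and F(c # a) = c_1 phi(c_2
    a) = 0; [tens_indep_rep] carries this to the second legs. *)
Lemma T3_null a d : (forall b, phi (b ** a) = 0) ->
  exists2 s : seq (A * A), T3 a d = \sum_(p <- s) p.1 \ox p.2 &
    forall p, p \in s -> forall b, phi (b ** p.2) = 0.
Proof.
move=> Na; have [s sE sP] := tens_indep_rep (T3 a d).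
exists s => // p ps c; apply: (sP (phi \o numul c)) => //.
rewrite -slice_r_rleg_l G_T3 -antipode_F.
suff -> : F (c \ox a) = 0 by rewrite linear0 numul0l.
apply: (numul_inj_r ndA) => f.
rewrite linear0 /F -slice_r_lleg_l T1_T2 slice_r_rleg_r slice_r_0 //.

Qed.

(* Let N be the left ideal of the a with phi(A a) = 0: by T3_null,
   Delta(N)(A # 1) lies in A # N.  If eps is nonzero at a point of N, then
   S(a_1 d) a_2 = eps(a) S(d) puts S(A) inside N, so phi = 0; otherwise
   iota # eps kills Delta(N)(A # 1), so N A = 0. *)
Lemma phi_faithful_r a : (forall b, phi (b ** a) = 0) -> a = 0.
Proof.
move=> Na; have [[x [Nx x0]]|counit0] :=
    EM (exists x, (forall b, phi (b ** x) = 0) /\ counit x != 0); last first.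
  apply: ndA.1 => d; rewrite -slice_counit_T3.
  have [s -> sP] := T3_null d Na.
  rewrite (linear_sum (slice_r counit)) big_seq big1 // => p /sP Np.
  rewrite /= slice_rE /=.
  have [->|p0] := eqVneq (counit p.2) 0; first by rewrite scale0r.
  by case: counit0; exists p.2.
have NS d b : phi (b ** antipode d) = 0.
  have [s sE sP] := T3_null d Nx.
  have : phi (b ** slice_l counit (T1' (T3 x d))) = 0.
    rewrite sE (linear_sum T1') (linear_sum (slice_l counit)).
    rewrite (linear_sum (numul b)) linear_sum big_seq big1 // => p /sP Np /=.
    by rewrite -antipode_numul numulA Np.
  rewrite slice_counit_T1'_T3 numulZr linearZ /= => /eqP.
  by rewrite mulf_eq0 (negPf x0) => /eqP.
have : phi e = 0.
  have [y ->] := prod_surj e.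
  elim/tens_ind: y => [|p q y IH]; first by rewrite !linear0.
  rewrite !linearD /= IH tens_prodE addr0.
  by rewrite -(antipode_starK q) NS.
by rewrite phi_e => /eqP; rewrite oner_eq0.
Qed.

Lemma phi_faithful_l a : (forall b, phi (a ** b) = 0) -> a = 0.
Proof.
move=> Na; apply: (can_inj (@starK _ A)); rewrite star0.
apply: phi_faithful_r => b.
by rewrite -(starK b) -starM phi_hermitian Na rmorph0.
Qed.

Lemma phi_definite a : phi (star a ** a) = 0 -> a = 0.
Proof.
move=> a0; apply: phi_faithful_r => b; rewrite -(starK b); set c := star b.
apply: contrapT => /eqP z0; set q := phi (star c ** c).
(* As in Cauchy-Schwarz: with this t, positivity at c + t a reads q - (q + 1) >= 0. *)
pose t := - (q + 1) / 2 / phi (star c ** a).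
have q_real : q^* = q by apply/CrealP; apply: ger0_real; apply: phi_pos.
have tz : t * phi (star c ** a) = - (q + 1) / 2 by rewrite /t mulfVK.
have := phi_pos (c + t *: a).
rewrite !(starD, starZ, numulDl, numulDr, numulZl, numulZr) !linearD /=.
rewrite !linearZ /= a0 !mulr0 addr0 [phi (star a ** c)]phi_hermitian_prod -rmorphM.
rewrite tz -/q rmorphM rmorphN rmorphD /= q_real fmorphV rmorph1 rmorph_nat.
have -> : q + - (q + 1) / 2 + - (q + 1) / 2 = -1 by field.
by rewrite oppr_ge0 ler10.
Qed.

(** * The coproduct, counit and antipode at a group-like projection *)

Section GroupLike.
Variable h : A.
Hypothesis h_neq0 : h != 0.
Hypothesis hh : h ** h = h.
Hypothesis h_star : star h = h.
Hypothesis Delta_h : Delta h ** rleg h = mult_of (h \ox h).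

Local Notation P := (@mult_of K AA (h \ox h)).

Lemma rleg_Delta_h : rleg h ** Delta h = P.
Proof.
have := congr1 star Delta_h.
rewrite starM mtens_star mone_star !star_mult_of h_star -Delta_star h_star.
by rewrite [star _]tens_star_tensor h_star.
Qed.

Lemma rleg_P : rleg h ** P = P.
Proof. by rewrite -mtens_mult_of mtensM mone_mull -mult_ofM hh. Qed.
Lemma P_lleg : P ** lleg h = P.
Proof. by rewrite -mtens_mult_of mtensM mone_mulr -mult_ofM hh. Qed.
Lemma lleg_P : lleg h ** P = P.
Proof. by rewrite -mtens_mult_of mtensM mone_mull -mult_ofM hh. Qed.
Lemma llegh2 : lleg h ** lleg h = lleg h.
Proof. by rewrite mtensM mone_mull -mult_ofM hh. Qed.
Lemma lleg_rleg : lleg h ** rleg h = P.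
Proof. by rewrite -mult_of_tens. Qed.
Lemma rleg_lleg : rleg h ** lleg h = P.
Proof. by rewrite -mult_of_tens_r. Qed.
Lemma P_Delta_h : P ** Delta h = P.
Proof. by rewrite -lleg_rleg -numulA rleg_Delta_h lleg_P lleg_rleg. Qed.
Lemma Delta_h_P : Delta h ** P = P.
Proof. by rewrite -rleg_lleg numulA Delta_h P_lleg rleg_lleg. Qed.

Lemma phi_h_neq0 : phi h != 0.
Proof.
apply/eqP => h0; move/eqP: h_neq0; apply.
by apply: phi_definite; rewrite h_star hh.
Qed.

Lemma T1_h b : T1 (h \ox (h ** b)) = h \ox (h ** b).
Proof.
apply: mult_inj; rewrite T1E.
have -> : rleg (h ** b) = rleg h ** rleg b by rewrite mtensM mone_mull -mult_ofM.
by rewrite numulA Delta_h -!mtens_mult_of mtensM mone_mulr -mult_ofM.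
Qed.

Lemma counit_h : counit h = 1.
Proof.
have := slice_counit_T1 (h \ox (h ** h)).
rewrite T1_h slice_lE tens_prodE hh hh => /(congr1 phi); rewrite linearZ /=.
by rewrite -[RHS]mul1r => /(mulIf phi_h_neq0).
Qed.

Lemma F_h b : F (h \ox (h ** b)) = phi (h ** b) *: h.
Proof. by rewrite /F T1_h slice_rE. Qed.

(** Both F(h # h) and G(h # h) equal phi(h) h, because star and flip fix h # h and phi(h) is real;
    phi(h) is non-zero. *)
Lemma antipode_h : antipode h = h.
Proof.
have Fh : F (h \ox h) = phi h *: h by rewrite -{2}hh F_h hh.
have : antipode (F (h \ox h)) = phi h *: h.
  rewrite antipode_F /G tswapE [star (h \ox h)]tens_star_tensor h_star Fh starZ.
  by rewrite -phi_hermitian h_star.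
rewrite Fh linearZ /= => /(congr1 ( *:%R (phi h)^-1)).
by rewrite !scalerA mulVf ?phi_h_neq0 // !scale1r.
Qed.

(* S(F(h # b) h) = h G(h # b) = G(h # h b) = S(F(h # h b)), and S is injective. *)
Lemma F_h_mul b : F (h \ox b) ** h = phi (h ** b) *: h.
Proof.
apply: (bij_inj antipode_bij).
rewrite antipodeM antipode_h antipode_F -F_h antipode_F.
rewrite !G_tensor -slice_r_lleg_l.
congr slice_r; apply: mult_inj; rewrite mult_of_lmul !T4E DeltaM !numulA.
by rewrite rleg_Delta_h lleg_rleg.
Qed.

(** The slice of Delta(h)(h # 1) by phi(. b) is F(h # b) h = phi(h b) h, the same as that of h # h;
    faithfulness of [phi] then separates the second legs. *)
Lemma T3_h : T3 h h = h \ox h.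
Proof.
apply/eqP; rewrite -subr_eq0; apply/eqP.
have [s sE sP] := tens_indep_rep (T3 h h - h \ox h).
rewrite sE big_seq big1 // => p ps; rewrite [p.2]phi_faithful_l ?linear0 // => b.
apply: (sP (phi \o numulr b)) => //.
rewrite linearB /= slice_rE -slice_r_rleg_r.
have -> : rmul (rleg b) (T3 h h) = rmul (lleg h) (T1 (h \ox b)).
  apply: mult_inj; rewrite !mult_of_rmul T3E T1E -!numulA.
  by rewrite legC.
by rewrite slice_r_lleg_r F_h_mul subrr.
Qed.

Lemma Delta_h_lleg : Delta h ** lleg h = P.
Proof. by rewrite -T3E T3_h. Qed.

Lemma lleg_Delta_h : lleg h ** Delta h = P.
Proof.
have := congr1 star Delta_h_lleg.
rewrite starM mtens_star mone_star !star_mult_of h_star -Delta_star h_star.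
by rewrite [star _]tens_star_tensor h_star.
Qed.

(** * The corner hAh and its coproduct *)

Local Notation D := (@corner K A h).
Local Notation DD := (tens D D).

Lemma corner_pred_sandwich x : corner_pred h (h ** x ** h).
Proof. by apply/asboolP; exists x. Qed.
Definition sandwich (x : A) : D := exist _ (h ** x ** h) (corner_pred_sandwich x).
Lemma sandwich_linear : linear sandwich.
Proof. by move=> k x y; apply: val_inj; rewrite /= linearP numulDl numulZl. Qed.
HB.instance Definition _ :=
  GRing.isLinear.Build K A D *:%R sandwich sandwich_linear.

Definition corner_val (x : D) : A := val x.
HB.instance Definition _ :=
  GRing.isLinear.Build K D A *:%R corner_val (@linearP _ _ _ _ val).
Lemma corner_val_inj : injective corner_val. Proof. exact: val_inj. Qed.
Lemma corner_valM (x y : D) : corner_val (x ** y) = corner_val x ** corner_val y.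
Proof. by []. Qed.
Lemma val_sandwich x : corner_val (sandwich x) = h ** x ** h. Proof. by []. Qed.

Lemma h_val (x : D) : h ** corner_val x = corner_val x.
Proof. by have /asboolP[a aE] := valP x; rewrite /corner_val aE !numulA hh. Qed.
Lemma val_h (x : D) : corner_val x ** h = corner_val x.
Proof. by have /asboolP[a aE] := valP x; rewrite /corner_val aE -!numulA hh. Qed.
Lemma sandwich_val (x : D) : sandwich (corner_val x) = x.
Proof. by apply: corner_val_inj; rewrite val_sandwich h_val val_h. Qed.
Lemma sandwich_sandwich x : sandwich (h ** x ** h) = sandwich x.
Proof. by apply: corner_val_inj; rewrite !val_sandwich !numulA hh -!numulA hh. Qed.

Let one : D := sandwich h.
Lemma val_one : corner_val one = h.
Proof. by rewrite val_sandwich !hh. Qed.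
Lemma one_is_identity : is_identity one.
Proof.
by move=> x; split; apply: corner_val_inj; rewrite corner_valM val_one
  (h_val, val_h).
Qed.

Lemma tmap_val_sandwich (z : AA) :
  tmap corner_val corner_val (tmap sandwich sandwich z) =
  (h \ox h) ** z ** (h \ox h).
Proof.
elim/tens_ind: z => [|p q z IH]; first by rewrite !linear0 numul0l.
by rewrite !linearD /= IH numulDl !tmap_tensor !tensM.
Qed.

Lemma tmap_sandwich2 (z : AA) :
  tmap sandwich sandwich ((h \ox h) ** z ** (h \ox h)) = tmap sandwich sandwich z.
Proof.
elim/tens_ind: z => [|p q z IH]; first by rewrite !linear0 numul0l linear0.
rewrite !linearD /= numulDl linearD /= IH; congr (_ + _).
by rewrite !tensM !tmap_tensor /= !sandwich_sandwich.
Qed.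

Lemma tmap_sandwich_eq (z z' : AA) :
  P ** mult_of z ** P = P ** mult_of z' ** P ->
  tmap sandwich sandwich z = tmap sandwich sandwich z'.
Proof.
rewrite -!mult_ofM => /mult_inj zz.
by rewrite -tmap_sandwich2 zz tmap_sandwich2.
Qed.

(** The compression of Delta(u) by h # h, for any u in A: the factor 1 # h makes Delta(u) an element
    of A # A and is absorbed by h # h. *)
Definition D0 (u : A) : DD := tmap sandwich sandwich (T1 (u \ox h)).
Lemma D0_linear : linear D0.
Proof. by move=> k x y; rewrite /D0 tensorDl tensorZl !linearP. Qed.
HB.instance Definition _ := GRing.isLinear.Build K A DD *:%R D0 D0_linear.

Lemma D0_T2 u : D0 u = tmap sandwich sandwich (T2 (h \ox u)).
Proof.
apply: tmap_sandwich_eq; rewrite T1E T2E !numulA P_lleg.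
by rewrite -!numulA rleg_P.
Qed.

(** Delta(h) is absorbed by h # h on either side. This lets the compression of a leg be dropped
    before the coproduct is applied again. *)
Lemma D0_sandwich u : D0 (h ** u ** h) = D0 u.
Proof.
apply: tmap_sandwich_eq; rewrite !T1E !DeltaM !numulA P_Delta_h.
by rewrite -!numulA !rleg_P Delta_h_P.
Qed.

Lemma val_D0 u : mult_of (tmap corner_val corner_val (D0 u)) = P ** Delta u ** P.
Proof. by rewrite tmap_val_sandwich !mult_ofM T1E -!numulA rleg_P. Qed.

Lemma Delta_val (a : D) :
  Delta (corner_val a) = Delta h ** Delta (corner_val a) ** Delta h.
Proof. by rewrite -!DeltaM h_val val_h. Qed.

Definition comul0 (a : D) : DD := D0 (corner_val a).
Lemma comul0_linear : linear comul0.
Proof. by move=> k x y; rewrite /comul0 !linearP. Qed.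
HB.instance Definition _ := GRing.isLinear.Build K D DD *:%R comul0 comul0_linear.

(** Since Delta(a) = Delta(h)Delta(a)Delta(h), and h # h and h # 1 both multiply Delta(h) to h # h,
    they compress Delta(a) to the same element. *)
Lemma val_comul0 (a : D) :
  mult_of (tmap corner_val corner_val (comul0 a)) =
  lleg h ** Delta (corner_val a) ** lleg h.
Proof.
rewrite val_D0 Delta_val !numulA P_Delta_h lleg_Delta_h.
by rewrite -!numulA Delta_h_P Delta_h_lleg.
Qed.

Lemma corner_comul_comul0 : corner_comul Delta (elt_comul comul0).
Proof. by move=> a; exists (comul0 a); split=> //; rewrite -val_D0. Qed.

Lemma comul0_sandwich u : comul0 (sandwich u) = D0 u.
Proof. exact: D0_sandwich. Qed.

(** By [comul0_sandwich] and [D0_T2], the two iterated coproducts are the compressions of the two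
    sides of [coassoc_elements] at c = b = h. *)
Lemma coassoc_comul0 a :
  tassoc (tmap comul0 idfun (comul0 a)) = tmap idfun comul0 (comul0 a).
Proof.
set u := corner_val a.
have -> : tmap comul0 idfun (comul0 a) = tmap (tmap sandwich sandwich) sandwich
    (tmap (T2 \o tensor h) idfun (T1 (u \ox h))).
  rewrite [comul0 a]/(tmap _ _ _) !tmap_comp; apply: eq_tmap => x //=.
  by rewrite comul0_sandwich D0_T2.
rewrite tassoc_tmap coassoc_elements tmap_comp.
rewrite [comul0 a]D0_T2 tmap_comp; apply: eq_tmap => x //=.
by rewrite comul0_sandwich.
Qed.

(** * Counit, integral and antipode on the corner *)

Lemma counit_sandwich x : counit (h ** x ** h) = counit x.
Proof. by rewrite !counitM counit_h mulr1 mul1r. Qed.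

Lemma slice_l_comul0 a : slice_l (counit \o corner_val) (comul0 a) = a.
Proof.
rewrite slice_l_tmap (@eq_slice_l _ _ _ _ counit).
  by rewrite slice_counit_T1 tens_prodE /= val_h sandwich_val.
exact: counit_sandwich.
Qed.

Lemma slice_r_comul0 a : slice_r (counit \o corner_val) (comul0 a) = a.
Proof.
rewrite [comul0 a]D0_T2 slice_r_tmap (@eq_slice_r _ _ _ _ counit).
  by rewrite slice_counit_T2 /= h_val sandwich_val.
exact: counit_sandwich.
Qed.

(** The corner contains [star b] along with b, so testing against it reduces the claim to
    definiteness of [phi]. *)
Lemma faithful_corner : faithful (phi \o corner_val : {scalar D}).
Proof.
move=> b b0; apply: corner_val_inj; rewrite linear0.
have bs : corner_val (sandwich (star (corner_val b))) = star (corner_val b).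
  have := congr1 star (h_val b); have := congr1 star (val_h b).
  by rewrite !starM h_star val_sandwich => -> ->.
case: b0 => /(_ (sandwich (star (corner_val b)))) /=; rewrite corner_valM bs => b0.
  exact: phi_definite.
apply: (can_inj (@starK _ A)); rewrite star0; apply: phi_definite.
by rewrite starK.
Qed.

(** With h only in the first leg, as in [val_comul0], the second leg is free for left invariance,
    and the slice is h phi(a) h. *)
Lemma slice_phi_comul0 a :
  slice_r (phi \o corner_val) (comul0 a) = (phi \o corner_val) a *: one.
Proof.
apply: corner_val_inj; rewrite -slice_r_tmap.
have -> : tmap corner_val corner_val (comul0 a) = lmul (lleg h) (T3 (corner_val a) h).
  by apply: mult_inj; rewrite val_comul0 mult_of_lmul T3E numulA.
by rewrite slice_r_lleg_l phi_T3 [LHS]linearZ [RHS]linearZ /= val_one hh.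
Qed.

Definition antipode0 (x : D) : D := sandwich (antipode (corner_val x)).
Lemma antipode0_linear : linear antipode0.
Proof. by move=> k x y; rewrite /antipode0 !linearP. Qed.
HB.instance Definition _ :=
  GRing.isLinear.Build K D D *:%R antipode0 antipode0_linear.

Lemma val_antipode0 x : corner_val (antipode0 x) = antipode (corner_val x).
Proof.
have := congr1 antipode (h_val x); have := congr1 antipode (val_h x).
by rewrite !antipodeM antipode_h val_sandwich => -> ->.
Qed.

Lemma antipode0_bij : bijective antipode0.
Proof.
exists (fun y => sandwich (star (antipode (star (corner_val y))))) => x.
  by rewrite val_antipode0 star_antipodeK sandwich_val.
apply: corner_val_inj; rewrite val_antipode0 val_sandwich !antipodeM antipode_h.
by rewrite antipode_starK val_h h_val.
Qed.

Lemma antipode0M a b : antipode0 (a ** b) = antipode0 b ** antipode0 a.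
Proof.
by apply: corner_val_inj; rewrite corner_valM !val_antipode0 corner_valM antipodeM.
Qed.

Lemma tmap_valM (x y : DD) : tmap corner_val corner_val (x ** y) =
  tmap corner_val corner_val x ** tmap corner_val corner_val y.
Proof.
elim/tens_ind: x => [|a b x IH]; first by rewrite !(linear0, numul0l).
rewrite numulDl !linearD /= numulDl IH; congr (_ + _) => {x IH}.
elim/tens_ind: y => [|c d y IH]; first by rewrite !linear0.
rewrite !linearD /= IH; congr (_ + _).
by rewrite tensM !tmap_tensor tensM.
Qed.

(** By [val_comul0] the two slices are h F(a # b) h and h G(a # b) h, and S takes the first to the
    second because S(h) = h. *)
Lemma antipode0_slice a b :
  antipode0 (slice_r (phi \o corner_val) (comul0 a ** (one \ox b))) =
  slice_r (phi \o corner_val) ((one \ox a) ** comul0 b).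
Proof.
apply: corner_val_inj.
rewrite val_antipode0 -!slice_r_tmap !tmap_valM !tmap_tensor /= val_one.
have -> : tmap corner_val corner_val (comul0 a) ** (h \ox corner_val b) =
    lmul (lleg h) (rmul (lleg h) (T1 (corner_val a \ox corner_val b))).
  apply: mult_inj; rewrite mult_ofM val_comul0 mult_of_lmul mult_of_rmul T1E.
  rewrite mult_of_tens -!numulA; congr (_ ** (_ ** _)).
  by rewrite numulA llegh2 legC.
have -> : (h \ox corner_val a) ** tmap corner_val corner_val (comul0 b) =
    lmul (lleg h) (rmul (lleg h) (T4 (corner_val a) (corner_val b))).
  apply: mult_inj; rewrite mult_ofM val_comul0 mult_of_lmul mult_of_rmul T4E.
  rewrite mult_of_tens_r !numulA; congr (_ ** _ ** _).
  by rewrite -numulA llegh2 legC.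
rewrite !slice_r_lleg_l !slice_r_lleg_r !antipodeM antipode_h.
rewrite -[slice_r phi (T1 _)]/(F _) antipode_F.
by rewrite G_tensor numulA.
Qed.

Lemma quantum_hypergroup_corner :
  quantum_hypergroup_compact_type (elt_comul comul0).
Proof.
have id1 := one_is_identity.
split; last by exists one.
split.
- exact: unital_nondegenerate id1.
- exact: in_alg_elt_comul id1 _.
- exact: coassociative_elt_comul id1 _ coassoc_comul0.
- exists (counit \o corner_val : {scalar D}).
  apply: (is_counit_elt_comul id1) slice_l_comul0 slice_r_comul0 => a b.
  exact: counitM.
- exists (phi \o corner_val : {scalar D}); split.
  + exact: faithful_corner.
  + exact: left_invariant_elt_comul id1 _ _ slice_phi_comul0.
  + exists (antipode0 : {linear D -> D}).
    exact: is_antipode_elt_comul id1 _ _ _ antipode0_bij antipode0M antipode0_slice.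
Qed.

Lemma corner_identity (f : D) : is_identity f -> val f = h.
Proof.
move=> /(_ one)[+ _]; have [_ ->] := one_is_identity f => ->.
exact: val_one.
Qed.

End GroupLike.

End QuantumGroup.

Theorem theorem2p7 (R : realType) (A : starAlgType R[i])
    (Delta : {linear A -> multiplier (tens A A)}) (h : A) :
  algebraic_quantum_group Delta ->
  group_like_projection Delta h ->
  exists Delta0 : {linear corner h -> multiplier (tens (corner h) (corner h))},
    [/\ corner_comul Delta Delta0,
        quantum_hypergroup_compact_type Delta0 &
        forall e : corner h, is_identity e -> val e = h].
Proof.
move=> [[ndA [DeltaM Delta_star] _ Delta_coassoc
  [[T1 [[T1' T1K T1'K] T1E]] [T2 [_ T2E]]]] [phi [[a a0] phi_pos phi_inv]]].
move=> [h_neq0 hh h_star Delta_h].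
(* Bijectivity of [T1] provides only a set-theoretic inverse; it inherits linearity. *)
have [T1i T1iE] : exists T1i : {linear tens A A -> tens A A}, T1i =1 T1'.
  by apply: linear_pack => k x y; apply: (can_inj T1K); rewrite linearP !T1'K.
have T1iK : cancel T1 T1i by move=> x; rewrite T1iE.
have T1Ki : cancel T1i T1 by move=> x; rewrite T1iE.
(* The normalised element e is a multiple of a witness that [phi] is non-zero. *)
have phi_e : phi ((phi a)^-1 *: a) = 1 by rewrite linearZ /= mulVf.
exists (elt_comul (@comul0 _ _ T1 h)).
split.
- exact: corner_comul_comul0.
- exact: (quantum_hypergroup_corner ndA DeltaM Delta_star Delta_coassoc
    T1E T2E T1iK T1Ki phi_inv phi_pos phi_e).
- by move=> f; exact: corner_identity.
Qed.
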